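(* Let $L>0$ and $a,b,c>0$, $p\in L^1[0,L]$, and consider the problem $$w''''(x)-\Big(a+b\int_0^L w(t)dt\Big)w''(x)+c\int_0^L w(t)dt=p(x)\ \text{a.e. in }(0,L),\quad w(0)=w(L)=w''(0)=w''(L)=0. \tag{P}$$ Let $M,N>0$ be constants with $N\le \frac{4M}{L^3}\sigma(\sqrt M L)$. Suppose (P) has a lower solution $\alpha$ and an upper solution $\beta$ such that $$0\le \alpha(x)\le\beta(x),\qquad 0\ge \alpha''(x)\ge\beta''(x)\quad\text{for all }x\in[0,L],$$ and $$a+b\int_0^L\beta(x)dx\le M,\qquad c-b\min_{x\in[0,L]}\beta''(x)\le N.$$ Then (P) has at least one solution in $[\alpha,\beta]:=\{u\in C^2[0,L]:\ \alpha\le u\le \beta,\ \alpha''\ge u''\ge \beta''\}$. Moreover, the sequences $(\alpha_n)$ and $(\beta_n)$ generated by the iteration below with $y_0=\alpha_0:=\alpha$ and $y_0=\beta_0:=\beta$ respectively satisfy, for all $n\ge1$, $$\alpha=\alpha_0\le\alpha_1\le\cdots\le\alpha_n\le\beta_n\le\cdots\le\beta_1\le\beta_0=\beta,$$ $$\alpha''=\alpha_0''\ge\alpha_1''\ge\cdots\ge\alpha_n''\ge\beta_n''\ge\cdots\ge\beta_1''\ge\beta_0''=\beta'',$$ and $\alpha_n$, $\beta_n$ converge uniformly on $[0,L]$ to the minimal solution $\underline y$ and the maximal solution $\overline y$ of (P) in $[\alpha,\beta]$, respectively (i.e., every solution $y$ of (P) in $[\alpha,\beta]$ satisfies $\underline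 y\le y\le\overline y$ and $\underline y''\ge y''\ge \overline y''$).
   Context: $\sigma(t):=\dfrac{3t^3}{6t\cosh t+6t-12\sinh t-t^3}$ for $t>0$. A solution of (P) is $w\in W^{4,1}[0,L]$ satisfying (P). A lower solution of (P) is $\alpha\in W^{4,1}[0,L]$ with $\alpha''''-(a+b\int_0^L\alpha)\alpha''+c\int_0^L\alpha\le p$ a.e. in $(0,L)$ and $\alpha(0)=\alpha(L)=\alpha''(0)=\alpha''(L)=0$; an upper solution is defined the same way with the inequality reversed. The iteration: given $y_{n-1}$, $y_n\in W^{4,1}[0,L]$ is the unique solution (which exists for any $M,N>0$) of $$y_n''''-My_n''+N\int_0^L y_n(t)dt=p(x)+\Big(a+b\int_0^L y_{n-1}(t)dt\Big)y_{n-1}''-c\int_0^L y_{n-1}(t)dt-My_{n-1}''+N\int_0^L y_{n-1}(t)dt,$$ $y_n(0)=y_n(L)=y_n''(0)=y_n''(L)=0$, $n=1,2,\dots$. *)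

(* Defs.v *)
From HB Require Import structures.
From mathcomp Require Import all_boot all_order all_algebra.
From mathcomp Require Import all_classical all_reals all_analysis.
Set Implicit Arguments. Unset Strict Implicit. Unset Printing Implicit Defensive.
Import Order.TTheory GRing.Theory Num.Theory.
Import numFieldNormedType.Exports.
Local Open Scope classical_set_scope.
Local Open Scope ring_scope.

Section defs.
Context {R : realType}.
Local Notation mu := (@lebesgue_measure R).

Definition coshR (t : R) : R := (expR t + expR (- t)) / 2.
Definition sinhR (t : R) : R := (expR t - expR (- t)) / 2.

Definition sigma (t : R) : R :=
  3 * t ^+ 3 / (6 * t * coshR t + 6 * t - 12 * sinhR t - t ^+ 3).

Definition int0 (x : R) (f : R -> R) : R := \int[mu]_(t in `[0, x]) f t.

(* w ∈ W^{4,1}[0,L], with w1, w2, w3, w4 its derivatives of order 1..4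
   (w4 the a.e. fourth derivative): w, w', w'' are C^1 and w''' is absolutely
   continuous on [0,L] with w'''' = w4 ∈ L^1[0,L], i.e. each is the integral of
   the next one on [0,L]. *)
Definition W41 (L : R) (w w1 w2 w3 w4 : R -> R) : Prop :=
  mu.-integrable `[0, L] (EFin \o w4) /\
  forall x, x \in `[0, L] ->
    [/\ w x = w 0 + int0 x w1,
        w1 x = w1 0 + int0 x w2,
        w2 x = w2 0 + int0 x w3 &
        w3 x = w3 0 + int0 x w4].

Definition Pop (L a b c : R) (w w2 w4 : R -> R) (x : R) : R :=
  w4 x - (a + b * int0 L w) * w2 x + c * int0 L w.

Definition ae0L (L : R) (P : R -> Prop) : Prop :=
  mu.-negligible [set x | (x \in `]0, L[) /\ ~ P x].

Definition BC (L : R) (w w2 : R -> R) : Prop :=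
  w 0 = 0 /\ w L = 0 /\ w2 0 = 0 /\ w2 L = 0.

Definition is_solP (L a b c : R) (p : R -> R) (w w1 w2 w3 w4 : R -> R) : Prop :=
  [/\ W41 L w w1 w2 w3 w4,
      ae0L L (fun x => Pop L a b c w w2 w4 x = p x)
    & BC L w w2].

Definition is_lowerP (L a b c : R) (p : R -> R) (w w1 w2 w3 w4 : R -> R) : Prop :=
  [/\ W41 L w w1 w2 w3 w4,
      ae0L L (fun x => Pop L a b c w w2 w4 x <= p x)
    & BC L w w2].

Definition is_upperP (L a b c : R) (p : R -> R) (w w1 w2 w3 w4 : R -> R) : Prop :=
  [/\ W41 L w w1 w2 w3 w4,
      ae0L L (fun x => p x <= Pop L a b c w w2 w4 x)
    & BC L w w2].

(* y (with derivatives y1..y4) is the iterate obtained from z (with second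
   derivative z2) in the monotone iteration with constants M, N. *)
Definition is_iterP (L a b c M N : R) (p : R -> R) (z z2 : R -> R)
    (y y1 y2 y3 y4 : R -> R) : Prop :=
  [/\ W41 L y y1 y2 y3 y4,
      ae0L L (fun x =>
        y4 x - M * y2 x + N * int0 L y =
        p x + (a + b * int0 L z) * z2 x - c * int0 L z - M * z2 x + N * int0 L z)
    & BC L y y2].

Definition in_ab (L : R) (al al2 be be2 u u2 : R -> R) : Prop :=
  forall x, x \in `[0, L] ->
    [/\ al x <= u x, u x <= be x, u2 x <= al2 x & be2 x <= u2 x].

Definition unif_cvg (L : R) (f : nat -> R -> R) (g : R -> R) : Prop :=
  forall e : R, 0 < e -> exists n0 : nat, forall n, (n0 <= n)%N ->
    forall x, x \in `[0, L] -> `|f n x - g x| < e.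

End defs.

(* Main.v *)
Require Import Defs.
From HB Require Import structures.
From mathcomp Require Import all_boot all_order all_algebra.
From mathcomp Require Import all_classical all_reals all_analysis.
From mathcomp Require Import measurable_realfun ring lra.
Set Implicit Arguments. Unset Strict Implicit. Unset Printing Implicit Defensive.
Import Order.TTheory GRing.Theory Num.Theory.
Import numFieldNormedType.Exports.
Local Open Scope classical_set_scope.
Local Open Scope ring_scope.

(* The operator [y'''' - M y'' + N int y] with hinged boundary values obeys a
   maximum principle: if it is nonnegative then [y >= 0] and [y'' <= 0]. Indeed,
   let [m^2 = M]. Then [v := - y''] vanishes at [0] and [L], and
   [h := - v'' + m^2 v + N k] is nonnegative, where [k = int y = int phi v] with
   [phi s = s (L - s) / 2]. Let [G] be the Green function of [- v'' + m^2 v], and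
   [e] and [psi] the responses to the loads [1] and [phi]. Integrating [h]
   against [G x] and against [psi], and eliminating [k], gives
     (1 + N int psi) v x
       = int ((1 + N int psi) G x s - N e x psi s) h s ds.
   Since [e] and [psi] lie below the multiples of [sinh (m x)] and
   [sinh (m (L - x))] that are tangent to them at the endpoints,
   [e x psi s / G x s] is largest at the corners [{x, s} = {0, L}] of the square,
   where the kernel is nonnegative exactly when [N <= 4 M / L^3 * sigma (m L)].

   Under the bounds on [beta], the iteration map therefore preserves the order
   ([y <= z] and [y'' >= z'']), so the iterates are monotone. Their second
   derivatives and integrals converge, hence so do, by dominated convergence,
   the fourth derivatives; integrating back, the Dirichlet conditions fix the
   constants of integration and give uniform limits solving the problem. *)

Local Notation mu := (@lebesgue_measure _).
Local Notation integrable0L L f := (mu.-integrable `[0, L] (EFin \o f)).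

Section integral_from_zero.
Context {R : realType}.
Implicit Types (L x y r : R) (f g : R -> R) (P Q : R -> Prop).

Lemma sub_itv0 L x y : x <= L -> y \in `[0, x] -> y \in `[0, L].
Proof. by move=> xL; rewrite !in_itv/= => /andP[-> /le_trans]; exact. Qed.

Lemma mem_itv0_bound L : 0 <= L -> L \in `[0, L].
Proof. by rewrite bound_itvE. Qed.

Lemma integrable0LS L x f : x <= L -> integrable0L L f -> integrable0L x f.
Proof. by move=> xL; apply: integrableS => // y; exact: sub_itv0. Qed.

Lemma integrable0LD L f g : integrable0L L f -> integrable0L L g ->
  integrable0L L (fun x => f x + g x).
Proof. by move=> fi gi; exact: (integrableD _ fi gi). Qed.

Lemma integrable0LZ L r f : integrable0L L f -> integrable0L L (fun x => r * f x).
Proof. by move=> fi; exact: (integrableZl _ r fi). Qed.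

Lemma integrable0LB L f g : integrable0L L f -> integrable0L L g ->
  integrable0L L (fun x => f x - g x).
Proof. by move=> fi gi; exact: (integrableB _ fi gi). Qed.

Lemma eq_integrable0L L f g : {in `[0, L], f =1 g} ->
  integrable0L L f -> integrable0L L g.
Proof. by move=> fg; apply: eq_integrable => // x; rewrite inE /= => /fg ->. Qed.

Lemma continuous_integrable0L L f : {within `[0, L], continuous f} ->
  integrable0L L f.
Proof.
by move=> cf; apply: continuous_compact_integrable cf; exact: segment_compact.
Qed.

Lemma integrable0L_cst L r : integrable0L L (fun=> r).
Proof.
by apply/continuous_integrable0L/continuous_subspaceT => ?; exact: cvg_cst.
Qed.

Lemma integrable0L_measurable L f : integrable0L L f ->
  measurable_fun `[0, L] f.
Proof. by move=> fi; apply/measurable_EFinP; exact: measurable_int fi. Qed.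

Lemma integrable0LMl L f g : integrable0L L f -> {within `[0, L], continuous g} ->
  integrable0L L (fun x => f x * g x).
Proof.
move=> fi cg.
have mg := integrable0L_measurable (continuous_integrable0L cg).
have [B [Breal gB]] :=
  compact_bounded (continuous_compact cg (@segment_compact _ 0 L)).
apply: (integrableMl _ fi mg) => //; exists B; split=> // r Br x xL.
by apply: gB Br _ _; exists x.
Qed.

Lemma integrable0LMr L f g : {within `[0, L], continuous f} -> integrable0L L g ->
  integrable0L L (fun x => f x * g x).
Proof.
by move=> cf gi; apply: eq_integrable0L (integrable0LMl gi cf) => x _; rewrite mulrC.
Qed.

Lemma int0_0 f : int0 0 f = 0.
Proof. by rewrite /int0 set_itv1 Rintegral_set1. Qed.

Lemma eq_int0 x f g : {in `[0, x], f =1 g} -> int0 x f = int0 x g.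
Proof. by move=> fg; apply: eq_Rintegral => y; rewrite inE => /fg. Qed.

Lemma int0D x f g : integrable0L x f -> integrable0L x g ->
  int0 x (fun s => f s + g s) = int0 x f + int0 x g.
Proof. exact: RintegralD. Qed.

Lemma int0B x f g : integrable0L x f -> integrable0L x g ->
  int0 x (fun s => f s - g s) = int0 x f - int0 x g.
Proof. exact: RintegralB. Qed.

Lemma int0Z x r f : integrable0L x f -> int0 x (fun s => r * f s) = r * int0 x f.
Proof. exact: RintegralZl. Qed.

Lemma int0_cst x r : 0 <= x -> int0 x (fun=> r) = r * x.
Proof.
rewrite le_eqVlt => /predU1P[<-|x0]; first by rewrite int0_0 mulr0.
by rewrite /int0 Rintegral_cst//= lebesgue_measure_itv/= lte_fin x0 sube0.
Qed.

Lemma le_int0 x f g : integrable0L x f -> integrable0L x g ->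
  {in `[0, x], forall s, f s <= g s} -> int0 x f <= int0 x g.
Proof. by move=> fi gi fg; apply: le_Rintegral => // s; exact: fg. Qed.

Lemma int0_ge0 x f : {in `[0, x], forall s, 0 <= f s} -> 0 <= int0 x f.
Proof. by move=> f0; apply: Rintegral_ge0 => s; exact: f0. Qed.

Lemma int0_nondecreasing L f x y : integrable0L L f ->
  {in `[0, L], forall s, 0 <= f s} -> 0 <= x -> x <= y -> y <= L ->
  int0 x f <= int0 y f.
Proof.
move=> fi f0 x0 xy yL; rewrite -subr_ge0 /int0 Rintegral_itvB ?bnd_simp//.
  apply: Rintegral_ge0 => s /=; rewrite in_itv/= => /andP[xs sy]; apply: f0.
  by rewrite in_itv/= (le_trans sy yL) (le_trans x0 (ltW xs)).
exact: integrable0LS fi.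
Qed.

Lemma normr_int0_le L x f g : integrable0L L f -> integrable0L L g ->
  {in `[0, L], forall s, `|f s| <= g s} -> x \in `[0, L] ->
  `|int0 x f| <= int0 L g.
Proof.
move=> fi gi fg xL; have [x0 xleL] : 0 <= x /\ x <= L by rewrite !(itvP xL).
have ni : integrable0L L (Num.norm \o f) by exact: integrable_norm.
apply: le_trans (le_int0 ni gi fg).
apply: (le_trans (le_normr_Rintegral _ (integrable0LS xleL fi))) => //.
by apply: (int0_nondecreasing ni) => // s _; exact: normr_ge0.
Qed.

Lemma int0_vanish_right L x f : integrable0L L f -> x \in `[0, L] ->
  {in `[x, L], forall s, f s = 0} -> int0 L f = int0 x f.
Proof.
move=> fi xL f0; apply/eqP; rewrite -subr_eq0 /int0.
rewrite Rintegral_itvB ?bnd_simp ?(itvP xL)//; apply/eqP.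
transitivity (\int[@lebesgue_measure R]_(s in `]x, L]) (0 : R)).
  by apply: eq_Rintegral => s; rewrite inE /= => /subset_itv_oc_cc/f0.
by rewrite Rintegral_cst// mul0r.
Qed.

Lemma ae0LS L P Q : (forall x, x \in `[0, L] -> P x -> Q x) ->
  ae0L L P -> ae0L L Q.
Proof.
move=> PQ; apply: negligibleS => x /= [xL nQ]; split => // Px; apply: nQ.
by apply: PQ Px; exact: subset_itv_oo_cc xL.
Qed.

Lemma ae0LT L P : (forall x, x \in `[0, L] -> P x) -> ae0L L P.
Proof.
move=> HP; apply: negligibleS (negligible_set0 _) => x /= [xL]; apply.
by apply: HP; exact: subset_itv_oo_cc xL.
Qed.

Lemma ae0L_and L P Q : ae0L L P -> ae0L L Q -> ae0L L (fun x => P x /\ Q x).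
Proof.
move=> aeP aeQ; apply: negligibleS (negligibleU aeP aeQ) => x /= [xL nPQ].
by have [Px|nP] := pselect (P x); [right|left]; split => // Qx; exact: nPQ.
Qed.

Lemma ae0L_sub L x P : x <= L -> ae0L L P -> ae0L x P.
Proof.
move=> xL; apply: negligibleS => s /= [+ nP]; rewrite in_itv/= => /andP[s0 sx].
by split => //; rewrite in_itv/= s0 (lt_le_trans sx).
Qed.

Lemma ae0L_ae L P : ae0L L P -> {ae mu, forall x, `[0, L]%classic x -> P x}.
Proof.
move=> aeP; have neg1 (r : R) : (@lebesgue_measure R).-negligible [set r].
  by apply/negligibleP => //; exact: lebesgue_measure_set1.
apply: negligibleS (negligibleU aeP (negligibleU (neg1 0) (neg1 L))).
move=> x /= /not_implyP[]; rewrite /= in_itv/= => /andP[x0 xL] nP.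
have [->|xn0] := eqVneq x 0; first by right; left.
have [->|xnL] := eqVneq x L; first by right; right.
by left; split => //; rewrite in_itv/= !lt_neqAle x0 xL xnL eq_sym xn0.
Qed.

Lemma ae_eq_int0 x f g : integrable0L x f -> integrable0L x g ->
  ae0L x (fun s => f s = g s) -> int0 x f = int0 x g.
Proof.
move=> fi gi fg; congr fine; apply: ae_eq_integral => //.
- exact: measurable_int fi.
- exact: measurable_int gi.
- by apply: negligibleS (ae0L_ae fg) => s; apply: contra_not => fgs /fgs /= ->.
Qed.

Lemma ae_int0_ge0 x f : integrable0L x f -> ae0L x (fun s => 0 <= f s) ->
  0 <= int0 x f.
Proof.
move=> fi f0; rewrite (@ae_eq_int0 _ _ (Num.norm \o f))//.
- by apply: int0_ge0 => s _ /=.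
- exact: integrable_norm.
- by apply: ae0LS f0 => s _ /= f0; rewrite ger0_norm.
Qed.

End integral_from_zero.

(* [F] is absolutely continuous on [0, L], with derivative [f] almost everywhere. *)
Definition primitive_on {R : realType} (L : R) (F f : R -> R) :=
  integrable0L L f /\ forall x, x \in `[0, L] -> F x = F 0 + int0 x f.

Section primitive_on.
Context {R : realType}.
Implicit Types (L x y p q r : R) (f g F G : R -> R).

Lemma primitive_onS L x F f : x <= L -> primitive_on L F f -> primitive_on x F f.
Proof.
move=> xL [fi FE]; split; first exact: integrable0LS fi.
by move=> y /(sub_itv0 xL)/FE.
Qed.

Lemma eq_primitive_on L F f G g : {in `[0, L], F =1 G} -> {in `[0, L], f =1 g} ->
  primitive_on L F f -> primitive_on L G g.
Proof.
move=> FG fg [fi FE]; split; first exact: eq_integrable0L fi.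
move=> x xL; have x0L : 0 \in `[0, L] by rewrite bound_itvE (itvP xL).
rewrite -(FG _ xL) -(FG _ x0L) FE//; congr (_ + _); apply: eq_int0 => s sx.
by apply: fg; apply: sub_itv0 sx; rewrite (itvP xL).
Qed.

Lemma primitive_onD L F f G g : primitive_on L F f -> primitive_on L G g ->
  primitive_on L (fun x => F x + G x) (fun x => f x + g x).
Proof.
move=> [fi FE] [gi GE]; split=> [|x xL]; first exact: integrable0LD.
have xleL : x <= L by rewrite (itvP xL).
rewrite int0D; [|exact: integrable0LS xleL _..].
by rewrite (FE _ xL) (GE _ xL) addrACA.
Qed.

Lemma primitive_onZ L r F f : primitive_on L F f ->
  primitive_on L (fun x => r * F x) (fun x => r * f x).
Proof.
move=> [fi FE]; split=> [|x xL]; first exact: integrable0LZ.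
have xleL : x <= L by rewrite (itvP xL).
by rewrite int0Z; [rewrite (FE _ xL) mulrDr|exact: integrable0LS xleL _].
Qed.

Lemma primitive_onB L F f G g : primitive_on L F f -> primitive_on L G g ->
  primitive_on L (fun x => F x - G x) (fun x => f x - g x).
Proof.
move=> pF /(primitive_onZ (-1)) pG.
by apply: eq_primitive_on (primitive_onD pF pG) => x _; rewrite mulN1r.
Qed.

Lemma primitive_on_cst L r : primitive_on L (fun=> r) (fun=> 0).
Proof.
split=> [|x xL]; first exact: integrable0L_cst.
by rewrite int0_cst ?(itvP xL)// mul0r addr0.
Qed.

Lemma primitive_on_id L : primitive_on L id (fun=> 1).
Proof.
split=> [|x xL]; first exact: integrable0L_cst.
by rewrite int0_cst ?(itvP xL)// mul1r add0r.
Qed.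

Lemma primitive_on_int0 L r f : integrable0L L f ->
  primitive_on L (fun x => r + int0 x f) f.
Proof. by move=> fi; split=> // x _; rewrite int0_0 addr0. Qed.

Lemma is_derive_primitive_on L F f : (forall x : R, is_derive x 1 F (f x)) ->
  continuous f -> primitive_on L F f.
Proof.
move=> dF cf; split; first exact/continuous_integrable0L/continuous_subspaceT.
move=> x; rewrite in_itv/= => /andP[]; rewrite le_eqVlt => /predU1P[<-|x0] _.
  by rewrite int0_0 addr0.
have cF : continuous F.
  by move=> s; apply/differentiable_continuous/derivable1_diffP; case: (dF s).
rewrite /int0 /Rintegral (@continuous_FTC2 _ f F)//=; first by rewrite subrKC.
- exact: continuous_subspaceT.
- split; first by move=> s _; case: (dF s).
  + exact/cvg_at_right_filter/cF.
  + exact/cvg_at_left_filter/cF.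
- by move=> s _; rewrite derive1E; case: (dF s).
Qed.

Lemma primitive_on_affine L p q F f :
  (forall x : R, is_derive x 1 F (f x)) -> continuous f ->
  primitive_on L (fun s => F (p * s + q)) (fun s => p * f (p * s + q)).
Proof.
move=> dF cf; apply: is_derive_primitive_on => [x|x].
  have da : is_derive x 1 (fun s => p * s + q) p.
    by apply: is_derive_eq; rewrite /GRing.scale/= mulr1 addr0.
  by apply: (is_derive_eq (is_derive1_comp (dF _) da)); rewrite mulrC.
apply: cvgM; first exact: cvg_cst.
apply: continuous_comp; last exact: cf.
by apply: cvgD; [apply: cvgM; [exact: cvg_cst|exact: cvg_id]|exact: cvg_cst].
Qed.

Lemma primitive_on_continuous L F f : 0 <= L -> primitive_on L F f ->
  {within `[0, L], continuous F}.
Proof.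
move=> L_ge0 [fi FE]; apply: (@subspace_eq_continuous _ _ _ (fun x => F 0 + int0 x f)).
  by move=> x; rewrite inE => /FE/esym.
move=> x; apply: cvgD; first exact: cvg_cst.
exact: (parameterized_integral_continuous L_ge0 fi).
Qed.

Lemma primitive_on_integrable L F f : 0 <= L -> primitive_on L F f ->
  integrable0L L F.
Proof. by move=> L_ge0 /(primitive_on_continuous L_ge0)/continuous_integrable0L. Qed.

Lemma primitive_on_bounded L F f : 0 <= L -> primitive_on L F f ->
  exists B, {in `[0, L], forall x, `|F x| <= B}.
Proof.
move=> L_ge0 /(primitive_on_continuous L_ge0) cF.
have [x _ Fmax] := @EVT_max R (Num.norm \o F) 0 L L_ge0
  (fun x => continuous_comp (cF x) (@norm_continuous _ _ _)).
by exists `|F x|.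
Qed.

Lemma ae_eq_primitive_on L F f g : primitive_on L F f -> integrable0L L g ->
  ae0L L (fun s => f s = g s) -> primitive_on L F g.
Proof.
move=> [fi FE] gi fg; split=> // x xL; have xleL : x <= L by rewrite (itvP xL).
rewrite FE//; congr (_ + _); apply: ae_eq_int0.
- exact: integrable0LS fi.
- exact: integrable0LS gi.
- exact: ae0L_sub fg.
Qed.

Lemma primitive_on_nondecreasing L F f x y : primitive_on L F f ->
  {in `[0, L], forall s, 0 <= f s} -> 0 <= x -> x <= y -> y <= L -> F x <= F y.
Proof.
move=> [fi FE] f0 x0 xy yL.
rewrite (FE x) ?(FE y) ?in_itv/= ?x0 ?(le_trans x0 xy) ?yL ?(le_trans xy yL)//.
by rewrite lerD2l; exact: int0_nondecreasing fi f0 x0 xy yL.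
Qed.

End primitive_on.

Section product_rule.

Lemma integrable_tensor d1 d2 (T1 : measurableType d1) (T2 : measurableType d2)
    (R : realType) (m1 : {sigma_finite_measure set T1 -> \bar R})
    (m2 : {sigma_finite_measure set T2 -> \bar R}) (f : T1 -> R) (g : T2 -> R) :
  m1.-integrable setT (EFin \o f) -> m2.-integrable setT (EFin \o g) ->
  (m1 \x m2)%E.-integrable setT (EFin \o (fun z => f z.1 * g z.2)).
Proof.
move=> /integrableP[mf fi] /integrableP[mg gi].
have /measurable_EFinP mf' := mf; have /measurable_EFinP mg' := mg.
apply/integrable12ltyP.
  apply/measurable_EFinP/measurable_funM.
  - exact: (measurableT_comp mf' (@measurable_fst _ _ T1 T2)).
  - exact: (measurableT_comp mg' (@measurable_snd _ _ T1 T2)).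
under eq_integral.
  move=> x _; under eq_integral do rewrite /= normrM EFinM.
  rewrite ge0_integralZl//; last exact/measurable_EFinP/measurableT_comp.
  over.
rewrite ge0_integralZr ?integral_ge0//; last exact/measurable_EFinP/measurableT_comp.
by rewrite lte_mul_pinfty ?ge0_fin_numE ?integral_ge0.
Qed.

Context {R : realType}.
Implicit Types (f g F G : R -> R) (A : set R).

Lemma integrable_patch A f : measurable A -> mu.-integrable A (EFin \o f) ->
  mu.-integrable setT (EFin \o (f \_ A)).
Proof.
by move=> mA fi; rewrite -restrict_EFin; apply/integrable_restrict; rewrite ?setTI.
Qed.

Lemma integralZ_patch A r f : measurable A -> mu.-integrable A (EFin \o f) ->
  (\int[mu]_s (r * (f \_ A) s)%:E = (r * \int[mu]_(s in A) f s)%:E)%E.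
Proof.
move=> mA fi; have fAi := integrable_patch mA fi.
rewrite Rintegral_mkcond -RintegralZl// /Rintegral fineK//.
by apply: integrable_fin_num => //; exact: (integrableZl _ r fAi).
Qed.

Lemma Rintegral_triangle f g :
  mu.-integrable setT (EFin \o f) -> mu.-integrable setT (EFin \o g) ->
  \int[mu]_s (f s * \int[mu]_(r in `]-oo, s]) g r) =
  \int[mu]_r (g r * \int[mu]_(s in `[r, +oo[) f s).
Proof.
move=> fi gi.
pose T := [set z : R * R | z.2 <= z.1]; pose k z := f z.1 * g z.2 * \1_T z.
have mT : measurable T.
  by rewrite -[T]setTI; exact: (measurable_fun_ler measurable_snd measurable_fst).
have ki : (mu \x mu)%E.-integrable setT (EFin \o k).
  apply: (integrableMl measurableT (integrable_tensor fi gi)).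
    exact: measurable_indic.
  exists 1; split=> // t t1 z _ /=.
  by rewrite indicE ger0_norm// (le_trans _ (ltW t1))// lern1 leq_b1.
have kE s r : k (s, r) = f s * (g r * (r <= s)%R%:R).
  by rewrite mulrA /k indicE (_ : ((s, r) \in T) = (r <= s))//; exact: asboolb.
have sectionl s : (\int[mu]_r (EFin \o k) (s, r) =
    (f s * \int[mu]_(r in `]-oo, s]) g r)%:E)%E.
  rewrite -integralZ_patch//; last exact: integrableS gi.
  apply: eq_integral => r _; rewrite [LHS]/= kE patchE mem_setE in_itv/=.
  by case: leP; rewrite ?mulr1 ?mulr0.
have sectionr r : (\int[mu]_s (EFin \o k) (s, r) =
    (g r * \int[mu]_(s in `[r, +oo[) f s)%:E)%E.
  rewrite -integralZ_patch//; last exact: integrableS fi.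
  apply: eq_integral => s _; rewrite [LHS]/= kE patchE mem_setE in_itv/= andbT.
  by rewrite mulrCA; case: leP; rewrite ?mulr1 ?mulr0.
have := Fubini ki; under eq_integral do rewrite sectionl.
by under [in X in _ = X -> _]eq_integral do rewrite sectionr; move=> /(congr1 fine).
Qed.

Lemma int0_triangle x f g : integrable0L x f -> integrable0L x g ->
  int0 x (fun s => f s * int0 s g) = int0 x (fun r => g r * (int0 x f - int0 r f)).
Proof.
move=> fi gi; have mx : measurable (`[0, x]%classic : set R) by [].
rewrite /int0 Rintegral_mkcond [RHS]Rintegral_mkcond.
have := Rintegral_triangle (integrable_patch mx fi) (integrable_patch mx gi).
congr (_ = _); apply: eq_Rintegral => s _; rewrite !patchE; case: ifPn;
    rewrite ?mul0r// inE/= in_itv/= => /andP[s0 sx]; congr (_ * _).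
  rewrite -Rintegral_mkcondr (_ : _ `&` _ = `[0, s]%classic)//.
  apply/seteqP; split=> r /=; rewrite !in_itv/=; first by move=> [-> /andP[->]].
  by move=> /andP[-> rs]; rewrite rs (le_trans rs).
rewrite Rintegral_itvB ?bnd_simp// Rintegral_itv_obnd_cbnd; last first.
  apply: integrableS fi => // r /=; rewrite !in_itv/= => /andP[sr ->].
  by rewrite (le_trans s0 (ltW sr)).
rewrite -Rintegral_mkcondr (_ : _ `&` _ = `[s, x]%classic)//.
apply/seteqP; split=> r /=; rewrite !in_itv/= ?andbT.
  by move=> [-> /andP[_ ->]].
by move=> /andP[sr ->]; rewrite sr (le_trans s0).
Qed.

Lemma primitive_onM L F f G g : 0 <= L -> primitive_on L F f ->
  primitive_on L G g ->
  primitive_on L (fun x => F x * G x) (fun x => f x * G x + F x * g x).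
Proof.
move=> L_ge0 pF pG.
have fGi := integrable0LMl pF.1 (primitive_on_continuous L_ge0 pG).
have Fgi := integrable0LMr (primitive_on_continuous L_ge0 pF) pG.1.
move: pF pG => [fi FE] [gi GE]; split; first exact: integrable0LD.
move=> x xL; have xleL : x <= L by rewrite (itvP xL).
move: (integrable0LS xleL fi) (integrable0LS xleL gi) (integrable0LS xleL fGi)
  (integrable0LS xleL Fgi) => {}fi {}gi {}fGi {}Fgi.
have FEx s : s \in `[0, x] -> int0 s f = F s - F 0.
  by move=> /(sub_itv0 xleL)/FE ->; rewrite addrC addKr.
have GEx s : s \in `[0, x] -> int0 s g = G s - G 0.
  by move=> /(sub_itv0 xleL)/GE ->; rewrite addrC addKr.
have triangle : int0 x (fun s => f s * G s) - G 0 * int0 x f =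
    F x * int0 x g - int0 x (fun s => F s * g s).
  rewrite -!int0Z// -!int0B//; [|exact: integrable0LZ..].
  transitivity (int0 x (fun s => f s * int0 s g)).
    by apply: eq_int0 => s /GEx ->; rewrite mulrBr (mulrC (G 0)).
  rewrite int0_triangle//; apply: eq_int0 => s sx.
  rewrite (FEx _ sx) FEx ?bound_itvE ?(itvP xL)//; ring.
have x0 : x \in `[0, x] by rewrite bound_itvE (itvP xL).
rewrite int0D// -(subrK (G 0 * int0 x f) (int0 x (fun s => f s * G s))) triangle.
by rewrite FEx// GEx//; ring.
Qed.

Lemma primitive_on_wronskian L f f1 f2 g g1 g2 : 0 <= L ->
  primitive_on L f f1 -> primitive_on L f1 f2 ->
  primitive_on L g g1 -> primitive_on L g1 g2 ->
  primitive_on L (fun s => f1 s * g s - f s * g1 s)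
    (fun s => f2 s * g s - f s * g2 s).
Proof.
move=> L_ge0 pf pf1 pg pg1.
apply: eq_primitive_on (primitive_onB (primitive_onM L_ge0 pf1 pg)
  (primitive_onM L_ge0 pf pg1)) => // s _.
by rewrite opprD addrA addrK.
Qed.

Lemma primitive_on_moment L f f1 f2 : 0 <= L ->
  primitive_on L f f1 -> primitive_on L f1 f2 ->
  primitive_on L (fun s => s * f1 s - f s) (fun s => s * f2 s).
Proof.
move=> L_ge0 pf pf1; apply: eq_primitive_on (primitive_onB
  (primitive_onM L_ge0 (primitive_on_id L) pf1) pf) => // s _ /=; ring.
Qed.

Lemma primitive_on_moment_reflect L f f1 f2 : 0 <= L ->
  primitive_on L f f1 -> primitive_on L f1 f2 ->
  primitive_on L (fun s => (L - s) * f1 s + f s) (fun s => (L - s) * f2 s).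
Proof.
move=> L_ge0 pf pf1; apply: eq_primitive_on (primitive_onB (primitive_onZ L pf1)
  (primitive_on_moment L_ge0 pf pf1)) => s _ /=; ring.
Qed.

End product_rule.

Section hyperbolic.
Context {R : realType}.
Implicit Types x y : R.

Lemma sinhR0 : sinhR 0 = 0 :> R.
Proof. by rewrite /sinhR oppr0 subrr mul0r. Qed.

Lemma coshR0 : coshR 0 = 1 :> R.
Proof. by rewrite /coshR oppr0 expR0; field. Qed.

Lemma sinhRB x y : sinhR (x - y) = sinhR x * coshR y - coshR x * sinhR y.
Proof. by rewrite /sinhR /coshR opprB !expRD; field. Qed.

Lemma coshR2_sinhR2 x : coshR x ^+ 2 - sinhR x ^+ 2 = 1.
Proof.
have e : expR x * expR (- x) = 1 by rewrite -expRD subrr expR0.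
by rewrite -[RHS]e /sinhR /coshR; field.
Qed.

Lemma sinhR_gt0 x : 0 < x -> 0 < sinhR x.
Proof. by move=> x0; rewrite divr_gt0// subr_gt0 ltr_expR; lra. Qed.

Lemma sinhR_ge0 x : 0 <= x -> 0 <= sinhR x.
Proof. by rewrite le_eqVlt => /predU1P[<-|/sinhR_gt0/ltW//]; rewrite sinhR0. Qed.

Lemma sinhR_exchange x y z :
  sinhR x * sinhR (z - y) - sinhR z * sinhR (x - y) = sinhR y * sinhR (z - x).
Proof. by rewrite !sinhRB; ring. Qed.

Global Instance is_derive_sinhR x : is_derive x 1 sinhR (coshR x).
Proof. by apply: is_derive_eq; rewrite /coshR /GRing.scale/=; field. Qed.

Global Instance is_derive_coshR x : is_derive x 1 coshR (sinhR x).
Proof. by apply: is_derive_eq; rewrite /sinhR /GRing.scale/=; field. Qed.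

Lemma continuous_sinhR : continuous (@sinhR R).
Proof. by move=> x; apply/differentiable_continuous/derivable1_diffP. Qed.

Lemma continuous_coshR : continuous (@coshR R).
Proof. by move=> x; apply/differentiable_continuous/derivable1_diffP. Qed.

End hyperbolic.

Section dirichlet.
Context {R : realType}.
Implicit Types (L m r : R) (f g : R -> R).

Definition dirichlet L f f1 f2 :=
  [/\ primitive_on L f f1, primitive_on L f1 f2, f 0 = 0 & f L = 0].

Definition screened m f f2 (s : R) := m ^+ 2 * f s - f2 s.

Lemma dirichlet_integrable L f f1 f2 : 0 <= L -> dirichlet L f f1 f2 ->
  integrable0L L f.
Proof. by move=> L_ge0 [pf _ _ _]; exact: primitive_on_integrable pf. Qed.

Lemma screened_integrable L m f f1 f2 : 0 <= L ->
  primitive_on L f f1 -> primitive_on L f1 f2 -> integrable0L L (screened m f f2).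
Proof.
move=> L_ge0 pf [f2i _]; apply: integrable0LB => //.
exact/integrable0LZ/(primitive_on_integrable L_ge0 pf).
Qed.

Lemma dirichletB L f f1 f2 g g1 g2 : dirichlet L f f1 f2 -> dirichlet L g g1 g2 ->
  dirichlet L (fun s => f s - g s) (fun s => f1 s - g1 s) (fun s => f2 s - g2 s).
Proof.
move=> [pf pf1 f0 fL] [pg pg1 g0 gL].
by split; rewrite ?f0 ?fL ?g0 ?gL ?subr0//; exact: primitive_onB.
Qed.

Lemma dirichletZ L r f f1 f2 : dirichlet L f f1 f2 ->
  dirichlet L (fun s => r * f s) (fun s => r * f1 s) (fun s => r * f2 s).
Proof.
by move=> [pf pf1 f0 fL]; split; rewrite ?f0 ?fL ?mulr0//; exact: primitive_onZ.
Qed.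

Lemma screened_symmetric L m f f1 f2 g g1 g2 : 0 <= L ->
  dirichlet L f f1 f2 -> dirichlet L g g1 g2 ->
  int0 L (fun s => f s * screened m g g2 s) = int0 L (fun s => screened m f f2 s * g s).
Proof.
move=> L_ge0 [pf pf1 f0 fL] [pg pg1 g0 gL]; apply/eqP; rewrite -subr_eq0 -int0B.
- have [_ /(_ _ (mem_itv0_bound L_ge0))] := primitive_on_wronskian L_ge0 pf pf1 pg pg1.
  rewrite f0 fL g0 gL !mulr0 !mul0r subrr add0r => W0; apply/eqP.
  by rewrite [RHS]W0; apply: eq_int0 => s _; rewrite /screened; ring.
- apply: integrable0LMr; first exact: primitive_on_continuous pf.
  exact: screened_integrable pg pg1.
- apply: integrable0LMl; first exact: screened_integrable pf pf1.
  exact: primitive_on_continuous pg.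
Qed.

Lemma dirichlet_slope L f f1 f2 : 0 <= L -> dirichlet L f f1 f2 ->
  L * f1 0 = - int0 L (fun s => (L - s) * f2 s).
Proof.
move=> L_ge0 [pf pf1 f0 fL].
have [_ /(_ _ (mem_itv0_bound L_ge0))] := primitive_on_moment_reflect L_ge0 pf pf1.
by rewrite fL f0; lra.
Qed.

Lemma dirichlet_concave_ge0 L f f1 f2 x : 0 < L -> dirichlet L f f1 f2 ->
  {in `[0, L], forall s, f2 s <= 0} -> x \in `[0, L] -> 0 <= f x.
Proof.
move=> L_gt0 [pf pf1 f0 fL] f2_le0; rewrite in_itv/= => /andP[x0 xL].
have left_le : x * f1 x - f x <= 0.
  have pl := primitive_onZ (-1) (primitive_on_moment (ltW L_gt0) pf pf1).
  have := primitive_on_nondecreasing pl _ (lexx 0) x0 xL.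
  rewrite f0 mul0r subr0 mulr0 !mulN1r oppr_ge0; apply=> s sL.
  by rewrite mulN1r oppr_ge0 mulr_ge0_le0 ?f2_le0// (itvP sL).
have right_ge : 0 <= (L - x) * f1 x + f x.
  have pr := primitive_onZ (-1) (primitive_on_moment_reflect (ltW L_gt0) pf pf1).
  have := primitive_on_nondecreasing pr _ x0 xL (lexx L).
  rewrite fL subrr mul0r addr0 mulr0 mulN1r oppr_le0; apply=> s sL.
  by rewrite mulN1r oppr_ge0 mulr_ge0_le0 ?f2_le0// subr_ge0 (itvP sL).
rewrite -(pmulr_rge0 _ L_gt0) (_ : L * f x =
  (L - x) * - (x * f1 x - f x) + x * ((L - x) * f1 x + f x)); last by ring.
by rewrite addr_ge0// mulr_ge0// ?subr_ge0// oppr_ge0.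
Qed.

End dirichlet.

Section green_function.
Context {R : realType}.
Variables (L m : R).
Hypotheses (L_gt0 : 0 < L) (m_gt0 : 0 < m).
Implicit Types (x s : R) (v : R -> R).

Let L_ge0 : 0 <= L. Proof. exact: ltW. Qed.
Let m_neq0 : m != 0. Proof. by rewrite gt_eqF. Qed.
Let sinh_gt0 : 0 < sinhR (m * L). Proof. by rewrite sinhR_gt0 ?mulr_gt0. Qed.

Lemma primitive_on_sinh_reflect x y : primitive_on y
  (fun s => sinhR (m * (x - s))) (fun s => - m * coshR (m * (x - s))).
Proof.
apply: eq_primitive_on (primitive_on_affine y (- m) (m * x) is_derive_sinhR
  continuous_coshR) => s _; by [congr sinhR; ring|congr (_ * coshR _); ring].
Qed.

Lemma primitive_on_cosh_reflect x y : primitive_on y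
  (fun s => coshR (m * (x - s))) (fun s => - m * sinhR (m * (x - s))).
Proof.
apply: eq_primitive_on (primitive_on_affine y (- m) (m * x) is_derive_coshR
  continuous_sinhR) => s _; by [congr coshR; ring|congr (_ * sinhR _); ring].
Qed.

Lemma duhamel v v1 v2 x : primitive_on L v v1 -> primitive_on L v1 v2 ->
  x \in `[0, L] ->
  m * v x = m * coshR (m * x) * v 0 + sinhR (m * x) * v1 0
    - int0 x (fun s => sinhR (m * (x - s)) * screened m v v2 s).
Proof.
move=> pv pv1 xL; have x0 : 0 <= x by rewrite (itvP xL).
have xleL : x <= L by rewrite (itvP xL).
have [_ /(_ _ (mem_itv0_bound x0))] := primitive_on_wronskian x0
  (primitive_on_sinh_reflect x x) (primitive_onZ (- m) (primitive_on_cosh_reflect x x))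
  (primitive_onS xleL pv) (primitive_onS xleL pv1).
rewrite subrr mulr0 sinhR0 coshR0 subr0.
rewrite (@eq_int0 _ x _ (fun s => sinhR (m * (x - s)) * screened m v v2 s)).
  by lra.
by move=> s _; rewrite /screened; ring.
Qed.

Definition green x s : R :=
  sinhR (m * Num.min x s) * sinhR (m * (L - Num.max x s)) / (m * sinhR (m * L)).

Lemma continuous_green x : continuous (green x).
Proof.
move=> s; apply: cvgM; last exact: cvg_cst.
have cmin : {for s, continuous (fun s => m * Num.min x s)}.
  apply: cvgM; first exact: cvg_cst.
  by apply: continuous_min; [exact: cvg_cst|exact: cvg_id].
have cmax : {for s, continuous (fun s => m * (L - Num.max x s))}.
  apply: cvgM; first exact: cvg_cst.
  apply: cvgB; first exact: cvg_cst.
  by apply: continuous_max; [exact: cvg_cst|exact: cvg_id].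
apply: cvgM; [exact: (continuous_comp cmin (@continuous_sinhR R _))|].
exact: (continuous_comp cmax (@continuous_sinhR R _)).
Qed.

Lemma green_ge0 x s : x \in `[0, L] -> s \in `[0, L] -> 0 <= green x s.
Proof.
move=> xL sL; apply: divr_ge0; last by rewrite mulr_ge0 ?ltW.
apply: mulr_ge0; apply: sinhR_ge0; rewrite pmulr_rge0//.
  by rewrite le_min !(itvP xL) !(itvP sL).
by rewrite subr_ge0 ge_max !(itvP xL) !(itvP sL).
Qed.

Lemma green_mul_integrable x h : integrable0L L h ->
  integrable0L L (fun s => green x s * h s).
Proof.
apply: integrable0LMr; apply: continuous_subspaceT; exact: continuous_green.
Qed.

Lemma green_representation v v1 v2 x : dirichlet L v v1 v2 -> x \in `[0, L] ->
  v x = int0 L (fun s => green x s * screened m v v2 s).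
Proof.
move=> [pv pv1 v0 vL] xL; have xleL : x <= L by rewrite (itvP xL).
set g := screened m v v2.
have gi : integrable0L L g by exact: screened_integrable pv pv1.
have sinh_gi y z : z <= L -> integrable0L z (fun s => sinhR (m * (y - s)) * g s).
  move=> zL; apply: integrable0LS zL (integrable0LMr _ gi).
  exact: primitive_on_continuous (primitive_on_sinh_reflect y L).
have slopeE : sinhR (m * L) * v1 0 = int0 L (fun s => sinhR (m * (L - s)) * g s).
  by have := duhamel pv pv1 (mem_itv0_bound L_ge0); rewrite v0 vL -/g; lra.
have split_green : int0 L (fun s => green x s * g s
    - sinhR (m * x) / (m * sinhR (m * L)) * (sinhR (m * (L - s)) * g s))
    = int0 x (fun s => - m^-1 * (sinhR (m * (x - s)) * g s)).
  rewrite (@int0_vanish_right _ _ x)//.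
  - apply: eq_int0 => s sx; rewrite /green min_r ?max_l ?(itvP sx)//.
    rewrite !mulrBr -sinhR_exchange; field.
    by rewrite m_neq0 gt_eqF.
  - by apply: integrable0LB; [exact: green_mul_integrable|exact/integrable0LZ/sinh_gi].
  - by move=> s sx; rewrite /green min_l ?max_r ?(itvP sx)//; ring.
move: split_green; rewrite int0B ?int0Z; [|exact: sinh_gi..|exact: green_mul_integrable|
  exact/integrable0LZ/sinh_gi].
rewrite -slopeE => /(canRL (subrK _)) ->.
have := duhamel pv pv1 xL; rewrite v0 -/g mulr0 add0r => /(canRL (mulKf m_neq0)) ->.
by field; rewrite m_neq0 gt_eqF.
Qed.

Lemma dirichlet_screened_ge0 v v1 v2 x : dirichlet L v v1 v2 ->
  ae0L L (fun s => 0 <= screened m v v2 s) -> x \in `[0, L] -> 0 <= v x.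
Proof.
move=> dv g0 xL; rewrite (green_representation dv xL); case: dv => pv pv1 _ _.
apply: ae_int0_ge0.
  exact/green_mul_integrable/(screened_integrable _ L_ge0 pv pv1).
by apply: ae0LS g0 => s sL; apply: mulr_ge0; exact: green_ge0.
Qed.

Lemma screened_le_homogeneous v v1 v2 x :
  primitive_on L v v1 -> primitive_on L v1 v2 ->
  ae0L L (fun s => 0 <= screened m v v2 s) -> x \in `[0, L] ->
  v x <= coshR (m * x) * v 0 + sinhR (m * x) / m * v1 0.
Proof.
move=> pv pv1 g0 xL; rewrite -(ler_pM2l m_gt0) (duhamel pv pv1 xL).
have xleL : x <= L by rewrite (itvP xL).
rewrite (_ : m * (_ + _) =
  m * coshR (m * x) * v 0 + sinhR (m * x) * v1 0); last by field.
rewrite gerBl; apply: ae_int0_ge0.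
  apply/(integrable0LS xleL)/integrable0LMr.
    exact: primitive_on_continuous (primitive_on_sinh_reflect x L).
  exact: screened_integrable pv pv1.
apply: ae0LS (ae0L_sub xleL g0) => s sx; apply: mulr_ge0.
by rewrite sinhR_ge0// mulr_ge0 ?(ltW m_gt0)// subr_ge0 (itvP sx).
Qed.

End green_function.

Definition sigma_den {R : realType} (t : R) : R :=
  6 * t * coshR t + 6 * t - 12 * sinhR t - t ^+ 3.

(* The hypothesis forces [sigma_den] to be positive: otherwise [sigma] is at
   most [0], being a division by zero where [sigma_den] vanishes. *)
Lemma le_sigma_den {R : realType} (L m N : R) : 0 < L -> 0 < m -> 0 < N ->
  N <= 4 * m ^+ 2 / L ^+ 3 * sigma (m * L) -> N * sigma_den (m * L) <= 12 * m ^+ 5.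
Proof.
move=> L_gt0 m_gt0 N_gt0; rewrite (_ : _ * sigma _ = 12 * m ^+ 5 / sigma_den (m * L)).
  move=> N_le; have m5 : 0 < 12 * m ^+ 5 by rewrite mulr_gt0 ?exprn_gt0.
  have den0 : 0 < sigma_den (m * L).
    by rewrite -invr_gt0 -(pmulr_rgt0 _ m5); exact: lt_le_trans N_le.
  by rewrite -ler_pdivlMr.
rewrite /sigma -/(sigma_den _) mulrA; congr (_ / _); field.
by rewrite gt_eqF.
Qed.

Section torsion.
Context {R : realType}.
Variables (L m : R).
Hypotheses (L_gt0 : 0 < L) (m_gt0 : 0 < m).
Implicit Types (x s : R).

Let L_ge0 : 0 <= L. Proof. exact: ltW. Qed.
Let m_neq0 : m != 0. Proof. by rewrite gt_eqF. Qed.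
Let sinh_gt0 : 0 < sinhR (m * L). Proof. by rewrite sinhR_gt0 ?mulr_gt0. Qed.
Let sinh_neq0 : sinhR (m * L) != 0. Proof. by rewrite gt_eqF. Qed.

(* The solutions with zero boundary values of [- u'' = 1], of
   [- u'' + m^2 u = 1] and of [- u'' + m^2 u = torsion]. *)
Definition torsion s : R := s * (L - s) / 2.
Definition torsion' s : R := L / 2 - s.

Definition screened_torsion s : R :=
  (1 - (sinhR (m * s) + sinhR (m * (L - s))) / sinhR (m * L)) / m ^+ 2.
Definition screened_torsion' s : R :=
  (coshR (m * (L - s)) - coshR (m * s)) / (m * sinhR (m * L)).
Definition screened_torsion'' s : R :=
  - (sinhR (m * s) + sinhR (m * (L - s))) / sinhR (m * L).

Definition iterated_torsion s : R := (torsion s - screened_torsion s) / m ^+ 2.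
Definition iterated_torsion' s : R := (torsion' s - screened_torsion' s) / m ^+ 2.
Definition iterated_torsion'' s : R := (-1 - screened_torsion'' s) / m ^+ 2.

Lemma dirichlet_torsion : dirichlet L torsion torsion' (fun=> -1).
Proof.
have pid := primitive_on_id L.
split; rewrite /torsion ?subrr ?mulr0 ?mul0r//.
  apply: eq_primitive_on (primitive_onZ 2^-1
    (primitive_onM L_ge0 pid (primitive_onB (primitive_on_cst L L) pid))) => s _ /=.
    by rewrite /torsion; field.
  by rewrite /torsion'; field.
by apply: eq_primitive_on (primitive_onB (primitive_on_cst L (L / 2)) pid) => s _ //=;
  rewrite sub0r.
Qed.

Lemma int0_torsion : int0 L torsion = L ^+ 3 / 12.
Proof.
have pid := primitive_on_id L; have psq := primitive_onM L_ge0 pid pid.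
have pT : primitive_on L (fun s => L * s ^+ 2 / 4 - s ^+ 3 / 6) torsion.
  apply: eq_primitive_on (primitive_onB (primitive_onZ (L / 4) psq)
    (primitive_onZ 6^-1 (primitive_onM L_ge0 pid psq))) => s _ /=.
    by field.
  by rewrite /torsion; field.
have [_ /(_ _ (mem_itv0_bound L_ge0))] := pT.
by rewrite !expr0n/= mulr0 !mul0r subrr add0r => <-; field.
Qed.

Lemma dirichlet_screened_torsion :
  dirichlet L screened_torsion screened_torsion' screened_torsion''.
Proof.
have psinh := primitive_on_affine L m 0 (@is_derive_sinhR R) (@continuous_coshR R).
have pcosh := primitive_on_affine L m 0 (@is_derive_coshR R) (@continuous_sinhR R).
have psinhr := primitive_on_sinh_reflect m L L.
have pcoshr := primitive_on_cosh_reflect m L L.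
split.
- apply: eq_primitive_on (primitive_onB (primitive_on_cst L (m ^- 2))
    (primitive_onZ (m ^- 2 / sinhR (m * L)) (primitive_onD psinh psinhr))) => s _.
    by rewrite /screened_torsion addr0; field; rewrite m_neq0 sinh_neq0.
  by rewrite /screened_torsion' addr0; field; rewrite m_neq0 sinh_neq0.
- apply: eq_primitive_on (primitive_onZ (m * sinhR (m * L))^-1
    (primitive_onB pcoshr pcosh)) => s _.
    by rewrite /screened_torsion' addr0 mulrC.
  by rewrite /screened_torsion'' addr0; field; rewrite m_neq0 sinh_neq0.
- by rewrite /screened_torsion subr0 mulr0 sinhR0 add0r divff// subrr mul0r.
- by rewrite /screened_torsion subrr mulr0 sinhR0 addr0 divff// subrr mul0r.
Qed.

Lemma screened_screened_torsion s :
  screened m screened_torsion screened_torsion'' s = 1.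
Proof.
rewrite /screened /screened_torsion /screened_torsion''; field.
by rewrite m_neq0 sinh_neq0.
Qed.

Lemma dirichlet_iterated_torsion :
  dirichlet L iterated_torsion iterated_torsion' iterated_torsion''.
Proof.
have [pt pt1 t0 tL] := dirichlet_torsion.
have [ps ps1 s0 sL] := dirichlet_screened_torsion.
split; rewrite /iterated_torsion ?t0 ?s0 ?tL ?sL ?subrr ?mul0r//.
- apply: eq_primitive_on (primitive_onZ (m ^- 2) (primitive_onB pt ps)) => s _;
    exact: mulrC.
- apply: eq_primitive_on (primitive_onZ (m ^- 2) (primitive_onB pt1 ps1)) => s _;
    exact: mulrC.
Qed.

Lemma screened_iterated_torsion s :
  screened m iterated_torsion iterated_torsion'' s = torsion s.
Proof.
have := screened_screened_torsion s.
rewrite /screened /iterated_torsion /iterated_torsion'' => e.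
rewrite -[in X in _ - (_ - X) / _](subKr (m ^+ 2 * screened_torsion s)
  (screened_torsion'' s)) e; field.
exact: m_neq0.
Qed.

Lemma torsion_ge0 s : s \in `[0, L] -> 0 <= torsion s.
Proof. by move=> sL; rewrite /torsion divr_ge0// mulr_ge0 ?subr_ge0 ?(itvP sL). Qed.

Lemma screened_torsion_ge0 s : s \in `[0, L] -> 0 <= screened_torsion s.
Proof.
apply: (dirichlet_screened_ge0 L_gt0 m_gt0 dirichlet_screened_torsion).
by apply: ae0LT => x _; rewrite screened_screened_torsion.
Qed.

Lemma iterated_torsion_ge0 s : s \in `[0, L] -> 0 <= iterated_torsion s.
Proof.
apply: (dirichlet_screened_ge0 L_gt0 m_gt0 dirichlet_iterated_torsion).
by apply: ae0LT => x /torsion_ge0; rewrite screened_iterated_torsion.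
Qed.

Lemma screened_torsion_le s : s \in `[0, L] ->
  screened_torsion s <= sinhR (m * s) / m * screened_torsion' 0.
Proof.
have [pst pst1 st0 _] := dirichlet_screened_torsion => sL.
have := screened_le_homogeneous L_gt0 m_gt0 pst pst1 _ sL.
rewrite st0 mulr0 add0r; apply.
by apply: ae0LT => x _; rewrite screened_screened_torsion.
Qed.

Lemma iterated_torsion_le s : s \in `[0, L] ->
  iterated_torsion s <= sinhR (m * s) / m * iterated_torsion' 0.
Proof.
have [pit pit1 it0 _] := dirichlet_iterated_torsion => sL.
have := screened_le_homogeneous L_gt0 m_gt0 pit pit1 _ sL.
rewrite it0 mulr0 add0r; apply.
by apply: ae0LT => x /torsion_ge0; rewrite screened_iterated_torsion.
Qed.

Lemma screened_torsion_reflect s : screened_torsion (L - s) = screened_torsion s.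
Proof. by rewrite /screened_torsion subKr (addrC (sinhR _)). Qed.

Lemma iterated_torsion_reflect s : iterated_torsion (L - s) = iterated_torsion s.
Proof.
by rewrite /iterated_torsion screened_torsion_reflect /torsion subKr (mulrC (L - s)).
Qed.

Lemma int0_iterated_torsion :
  int0 L iterated_torsion = (L ^+ 3 / 12 - 2 * iterated_torsion' 0) / m ^+ 2.
Proof.
have [_ pit1 _ _] := dirichlet_iterated_torsion.
have it_integrable := dirichlet_integrable L_ge0 dirichlet_iterated_torsion.
have slope_reflect : iterated_torsion' L = - iterated_torsion' 0.
  rewrite /iterated_torsion' /torsion' /screened_torsion' !subr0 !subrr !mulr0; field.
  by rewrite m_neq0 sinh_neq0.
have [_ /(_ _ (mem_itv0_bound L_ge0))] := pit1; rewrite slope_reflect => slopeE.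
have torsionE : L ^+ 3 / 12 =
    m ^+ 2 * int0 L iterated_torsion - int0 L iterated_torsion''.
  rewrite -int0_torsion -int0Z// -int0B; [|exact: integrable0LZ|exact: pit1.1].
  by apply: eq_int0 => s _; rewrite -screened_iterated_torsion.
by apply: (canRL (mulfK _)); [rewrite expf_neq0|rewrite mulrC; lra].
Qed.

(* The supremum of [screened_torsion x * iterated_torsion s / green L m x s],
   attained in the limit at the corner [x = L], [s = 0] of the square. *)
Definition corner_ratio : R :=
  screened_torsion' 0 * iterated_torsion' 0 * sinhR (m * L) / m.

Lemma torsion_mul_le_green x s : x \in `[0, L] -> s \in `[0, L] ->
  screened_torsion x * iterated_torsion s <= corner_ratio * green L m x s.
Proof.
have reflect y : y \in `[0, L] -> L - y \in `[0, L].
  by rewrite !in_itv/= => /andP[y0 yL]; rewrite subr_ge0 yL gerBl.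
move=> xL sL; have st0 := screened_torsion_ge0 xL; have it0 := iterated_torsion_ge0 sL.
rewrite /corner_ratio /green; have [_|_] := leP x s.
  move: it0 (iterated_torsion_le (reflect _ sL)); rewrite iterated_torsion_reflect.
  move=> it0 its; apply: (le_trans (ler_pM st0 it0 (screened_torsion_le xL) its)).
  rewrite le_eqVlt; apply/predU1P; left; field.
  by rewrite m_neq0 sinh_neq0.
move: st0 (screened_torsion_le (reflect _ xL)); rewrite screened_torsion_reflect.
move=> st0 stx; apply: (le_trans (ler_pM st0 it0 stx (iterated_torsion_le sL))).
rewrite le_eqVlt; apply/predU1P; left; field.
by rewrite m_neq0 sinh_neq0.
Qed.

Lemma corner_ratioB_int0 :
  corner_ratio - int0 L iterated_torsion = sigma_den (m * L) / (12 * m ^+ 5).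
Proof.
rewrite int0_iterated_torsion /corner_ratio /sigma_den /iterated_torsion'
  /screened_torsion' /torsion' !subr0 mulr0 coshR0.
have := coshR2_sinhR2 (m * L); have := sinh_neq0.
move: (sinhR _) (coshR _) => sh ch sh0 /(canRL (subrK _)) ch2.
apply/eqP; rewrite -subr_eq0; apply/eqP.
transitivity ((1 + sh ^+ 2 - ch ^+ 2) / (m ^+ 5 * sh)); last first.
  by rewrite ch2 subrr mul0r.
by field; rewrite m_neq0 sh0.
Qed.

Lemma corner_ratio_le N : N * sigma_den (m * L) <= 12 * m ^+ 5 ->
  N * corner_ratio <= 1 + N * int0 L iterated_torsion.
Proof.
move=> N_le; have m5 : 0 < 12 * m ^+ 5 by rewrite mulr_gt0 ?exprn_gt0.
have := corner_ratioB_int0 => /(canRL (subrK _)) ->.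
by rewrite mulrDr lerD2r mulrA ler_pdivrMr// mul1r.
Qed.

Lemma int0_green x : x \in `[0, L] -> int0 L (green L m x) = screened_torsion x.
Proof.
move=> xL; rewrite (green_representation L_gt0 m_gt0 dirichlet_screened_torsion xL).
by apply: eq_int0 => s _; rewrite screened_screened_torsion mulr1.
Qed.

Lemma int0_iterated_torsion_screened v v1 v2 : dirichlet L v v1 v2 ->
  int0 L (fun s => iterated_torsion s * screened m v v2 s) =
  int0 L (fun s => torsion s * v s).
Proof.
move=> dv; rewrite (screened_symmetric _ L_ge0 dirichlet_iterated_torsion dv).
by apply: eq_int0 => s _; rewrite screened_iterated_torsion.
Qed.

Lemma nonlocal_green_representation N v v1 v2 x : dirichlet L v v1 v2 ->
  x \in `[0, L] ->
  (1 + N * int0 L iterated_torsion) * v x =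
  int0 L (fun s => ((1 + N * int0 L iterated_torsion) * green L m x s
    - N * screened_torsion x * iterated_torsion s)
    * (screened m v v2 s + N * int0 L (fun r => torsion r * v r))).
Proof.
move=> dv xL; set k := int0 L (fun r => torsion r * v r); set I := int0 L _.
have [pv pv1 _ _] := dv; have [pit _ _ _] := dirichlet_iterated_torsion.
have gi : integrable0L L (screened m v v2) by exact: screened_integrable pv pv1.
have green_gi := green_mul_integrable m x gi.
have green_i : integrable0L L (green L m x).
  by apply/continuous_integrable0L/continuous_subspaceT => s; exact: continuous_green.
have it_i := dirichlet_integrable L_ge0 dirichlet_iterated_torsion.
have it_gi := integrable0LMr (primitive_on_continuous L_ge0 pit) gi.
rewrite (@eq_int0 _ L _ (fun s =>
    (1 + N * I) * (green L m x s * screened m v v2 s + N * k * green L m x s)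
    - N * screened_torsion x * (iterated_torsion s * screened m v v2 s
      + N * k * iterated_torsion s))); last by move=> s _; ring.
rewrite int0B ?int0Z ?int0D ?int0Z;
  do ?[apply: integrable0LZ|apply: integrable0LD] => //.
rewrite -(green_representation L_gt0 m_gt0 dv xL) (int0_iterated_torsion_screened dv).
by rewrite (int0_green xL) -/I -/k; ring.
Qed.

Lemma nonlocal_screened_ge0 N v v1 v2 x : 0 <= N ->
  N * sigma_den (m * L) <= 12 * m ^+ 5 -> dirichlet L v v1 v2 ->
  ae0L L (fun s => 0 <= screened m v v2 s + N * int0 L (fun r => torsion r * v r)) ->
  x \in `[0, L] -> 0 <= v x.
Proof.
move=> N_ge0 N_le dv h0 xL; have [pv pv1 _ _] := dv.
have [pit _ _ _] := dirichlet_iterated_torsion.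
have I0 : 0 < 1 + N * int0 L iterated_torsion.
  rewrite ltr_pwDl// mulr_ge0//; apply: int0_ge0.
  exact: iterated_torsion_ge0.
rewrite -(pmulr_rge0 _ I0) (nonlocal_green_representation N dv xL).
apply: ae_int0_ge0.
  apply: integrable0LMr.
    move=> s; apply: cvgB; apply: cvgM; try exact: cvg_cst.
      by apply: continuous_subspaceT => z; exact: continuous_green.
    exact: primitive_on_continuous pit s.
  apply: integrable0LD; last exact: integrable0L_cst.
  exact: screened_integrable pv pv1.
apply: ae0LS h0 => s sL; apply: mulr_ge0; rewrite subr_ge0 -mulrA.
apply: (le_trans (ler_wpM2l N_ge0 (torsion_mul_le_green xL sL))).
by rewrite mulrA ler_wpM2r ?green_ge0 ?corner_ratio_le.
Qed.

End torsion.

Record hinged {R : realType} (L : R) := Hinged {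
  hinged_fun :> R -> R;
  d1 : R -> R; d2 : R -> R; d3 : R -> R; d4 : R -> R;
  hinged_W41 : W41 L hinged_fun d1 d2 d3 d4;
  hinged_BC : BC L hinged_fun d2 }.

Section hinged.
Context {R : realType}.
Implicit Types L M N : R.

Lemma hinged_dirichlet L (u : hinged L) : 0 <= L ->
  dirichlet L u (d1 u) (d2 u) /\ dirichlet L (d2 u) (d3 u) (d4 u).
Proof.
move=> L_ge0; have [u4i uE] := hinged_W41 u; have [u0 [uL [u20 u2L]]] := hinged_BC u.
have p3 : primitive_on L (d3 u) (d4 u) by split=> // x /uE[].
have p2 : primitive_on L (d2 u) (d3 u).
  by split=> [|x /uE[]//]; exact: primitive_on_integrable p3.
have p1 : primitive_on L (d1 u) (d2 u).
  by split=> [|x /uE[]//]; exact: primitive_on_integrable p2.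
by split; split=> //; split=> [|x /uE[]//]; exact: primitive_on_integrable p1.
Qed.

Lemma dirichlet_hinged L (f f1 f2 f3 f4 : R -> R) :
  dirichlet L f f1 f2 -> dirichlet L f2 f3 f4 -> W41 L f f1 f2 f3 f4 /\ BC L f f2.
Proof.
move=> [[_ fE] [_ f1E] f0 fL] [[_ f2E] [f4i f3E] f20 f2L]; split=> //.
by split=> // x xL; split; [exact: fE|exact: f1E|exact: f2E|exact: f3E].
Qed.

Definition hinged_of_dirichlet L (f f1 f2 f3 f4 : R -> R)
    (df : dirichlet L f f1 f2) (df2 : dirichlet L f2 f3 f4) : hinged L :=
  Hinged (dirichlet_hinged df df2).1 (dirichlet_hinged df df2).2.

Definition hinged_sub L (L_ge0 : 0 <= L) (u w : hinged L) : hinged L :=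
  hinged_of_dirichlet
    (dirichletB (hinged_dirichlet u L_ge0).1 (hinged_dirichlet w L_ge0).1)
    (dirichletB (hinged_dirichlet u L_ge0).2 (hinged_dirichlet w L_ge0).2).

Lemma hinged_integrable L (u : hinged L) : 0 <= L -> integrable0L L u.
Proof. by move=> L_ge0; exact: dirichlet_integrable (hinged_dirichlet u L_ge0).1. Qed.

Lemma hinged_int0 L (u : hinged L) : 0 < L ->
  int0 L u = int0 L (fun s => torsion L s * - d2 u s).
Proof.
move=> L_gt0; have [du _] := hinged_dirichlet u (ltW L_gt0).
transitivity (int0 L (fun s => screened 0 (torsion L) (fun=> -1) s * u s)).
  by apply: eq_int0 => s _; rewrite /screened; ring.
rewrite -(screened_symmetric 0 (ltW L_gt0) (dirichlet_torsion L_gt0) du).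
by apply: eq_int0 => s _; rewrite /screened; ring.
Qed.

Lemma hinged_maximum_principle L M N (u : hinged L) x : 0 < L -> 0 < M -> 0 < N ->
  N <= 4 * M / L ^+ 3 * sigma (Num.sqrt M * L) ->
  ae0L L (fun s => 0 <= d4 u s - M * d2 u s + N * int0 L u) ->
  x \in `[0, L] -> 0 <= u x /\ d2 u x <= 0.
Proof.
move=> L_gt0 M_gt0 N_gt0 N_le u_ge0; have [du du2] := hinged_dirichlet u (ltW L_gt0).
have m_gt0 : 0 < Num.sqrt M by rewrite sqrtr_gt0.
have mM : Num.sqrt M ^+ 2 = M by rewrite sqr_sqrtr// ltW.
have d2_le0 : {in `[0, L], forall s, d2 u s <= 0}.
  move=> s sL; rewrite -oppr_ge0 -mulN1r.
  apply: (nonlocal_screened_ge0 L_gt0 m_gt0 (ltW N_gt0) _ (dirichletZ (-1) du2)) => //.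
    by apply: le_sigma_den => //; rewrite mM.
  apply: ae0LS u_ge0 => r _; rewrite hinged_int0// /screened mM.
  rewrite (@eq_int0 _ L _ (fun s => torsion L s * (-1 * d2 u s))).
    by congr (0 <= _); ring.
  by move=> t _; rewrite mulN1r.
by move=> xL; split; [exact: dirichlet_concave_ge0 du d2_le0 xL|exact: d2_le0].
Qed.

End hinged.

Section dominated_limits.
Context {R : realType}.
Implicit Types (L r : R) (F f h : nat -> R -> R) (e : nat -> R) (g : R -> R).

Lemma unif_cvg_squeeze L F g e :
  (forall n, {in `[0, L], forall x, `|F n x - g x| <= e n}) ->
  e n @[n --> \oo] --> 0 -> unif_cvg L F g.
Proof.
move=> Fe /cvgrPdist_lt e0 d d0; have [n0 _ en0] := e0 _ d0.
exists n0 => n n0n x xL; apply: (le_lt_trans (Fe n x xL)).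
by apply: (le_lt_trans (ler_norm _)); have := en0 _ n0n; rewrite /= sub0r normrN.
Qed.

Lemma unif_cvg_pointwise L F g x : unif_cvg L F g -> x \in `[0, L] ->
  F n x @[n --> \oo] --> g x.
Proof.
move=> Fg xL; apply/cvgrPdist_lt => e e0; have [n0 Fe] := Fg e e0.
by exists n0 => // n /= n0n; rewrite distrC; exact: Fe.
Qed.

Lemma unif_cvg_int0 L f g : 0 < L -> (forall n, integrable0L L (f n)) ->
  integrable0L L g -> unif_cvg L f g -> int0 L (f n) @[n --> \oo] --> int0 L g.
Proof.
move=> L_gt0 fi gi fg; apply/cvgrPdist_lt => e e0.
have e2L : 0 < e / 2 / L by rewrite !divr_gt0.
have [n0 fe] := fg _ e2L; exists n0 => // n /= n0n; rewrite distrC -int0B//.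
have fge : {in `[0, L], forall s, `|f n s - g s| <= e / 2 / L}.
  by move=> s sL; exact/ltW/fe.
have := normr_int0_le (integrable0LB (fi n) gi) (integrable0L_cst L _) fge
  (mem_itv0_bound (ltW L_gt0)).
by rewrite int0_cst ?(ltW L_gt0)// divfK ?gt_eqF//; lra.
Qed.

Lemma cvgn_normr_bounded e r : e n @[n --> \oo] --> r ->
  exists B, forall n, `|e n| <= B.
Proof.
move=> er; have /cvg_seq_bounded[B [_ eB]] : cvgn e by apply/cvg_ex; exists r.
by exists (B + 1) => n; apply: eB => //; rewrite ltrDl.
Qed.

Definition cvg_dominated L f finf :=
  {in `[0, L], forall x, f n x @[n --> \oo] --> (finf x : R)} /\
  exists2 g, integrable0L L g & forall n, {in `[0, L], forall x, `|f n x| <= g x}.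

Lemma cvg_dominated_const L g : integrable0L L g -> cvg_dominated L (fun=> g) g.
Proof.
move=> gi; split=> [x _|]; first exact: cvg_cst.
by exists (Num.norm \o g) => [|n x _ /=]; first exact: integrable_norm.
Qed.

Lemma cvg_dominatedS L f finf : cvg_dominated L f finf ->
  cvg_dominated L (fun n => f n.+1) finf.
Proof.
move=> [ff [g gi fg]]; split=> [x xL|]; last by exists g.
by rewrite (cvg_shiftS (fun n => f n x)); exact: ff.
Qed.

Lemma cvg_dominatedD L f finf h hinf :
  cvg_dominated L f finf -> cvg_dominated L h hinf ->
  cvg_dominated L (fun n x => f n x + h n x) (fun x => finf x + hinf x).
Proof.
move=> [ff [g gi fg]] [hh [k ki hk]]; split=> [x xL|].
  by apply: cvgD; [exact: ff|exact: hh].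
exists (fun x => g x + k x) => [|n x xL]; first exact: integrable0LD.
by apply: (le_trans (ler_normD _ _)); rewrite lerD ?fg ?hk.
Qed.

Lemma cvg_dominatedZ L e r f finf : e n @[n --> \oo] --> r ->
  cvg_dominated L f finf ->
  cvg_dominated L (fun n x => e n * f n x) (fun x => r * finf x).
Proof.
move=> er [ff [g gi fg]]; have [B eB] := cvgn_normr_bounded er; split=> [x xL|].
  by apply: cvgM => //; exact: ff.
exists (fun x => B * g x) => [|n x xL]; first exact: integrable0LZ.
by rewrite normrM ler_pM// fg.
Qed.

Lemma cvg_dominated_cst L e r : e n @[n --> \oo] --> r ->
  cvg_dominated L (fun n _ => e n) (fun=> r).
Proof.
move=> er; have [B eB] := cvgn_normr_bounded er.
by split=> //; exists (fun=> B) => [|n x _]; first exact: integrable0L_cst.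
Qed.

Lemma cvg_dominated_integrable L f finf : (forall n, integrable0L L (f n)) ->
  cvg_dominated L f finf ->
  integrable0L L finf /\ int0 L (fun x => `|f n x - finf x|) @[n --> \oo] --> 0.
Proof.
move=> fi [ff [g gi fg]].
have mf n : measurable_fun `[0, L] (f n) by exact: integrable0L_measurable.
have [||||] := @dominated_convergence _ _ R mu `[0, L]%classic (measurable_itv _)
  (fun n => EFin \o f n) (EFin \o finf) (EFin \o g) _ _ _ gi _.
- by move=> n; exact: measurable_int (fi n).
- by apply/measurable_EFinP; apply: (measurable_fun_cvg mf) => x; exact: ff.
- by apply/aeW => x xL; apply: cvg_EFin; [exact: nearW|exact: ff].
- by apply/aeW => x n xL; rewrite /= lee_fin; exact: fg.
by move=> finfi cvg0 _; split=> //; have /fine_cvgP[_] := cvg0.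
Qed.

Lemma primitive_on_dominated L F f finf r : 0 <= L ->
  (forall n, primitive_on L (F n) (f n)) -> cvg_dominated L f finf ->
  F n 0 @[n --> \oo] --> r ->
  primitive_on L (fun x => r + int0 x finf) finf /\
  unif_cvg L F (fun x => r + int0 x finf).
Proof.
move=> L_ge0 pF ff F0; have fi n := (pF n).1.
have [finfi int_cvg0] := cvg_dominated_integrable fi ff.
split; first exact: primitive_on_int0.
apply: (@unif_cvg_squeeze _ _ _
  (fun n => `|F n 0 - r| + int0 L (fun x => `|f n x - finf x|))) => [n x xL|].
  have xleL : x <= L by rewrite (itvP xL).
  rewrite (pF n).2// opprD addrACA.
  rewrite -int0B; [|exact: integrable0LS xleL (fi n)|exact: integrable0LS xleL finfi].
  apply: (le_trans (ler_normD _ _)); rewrite lerD2l.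
  have di := integrable0LB (fi n) finfi.
  by apply: (normr_int0_le di _ _ xL) => //; exact: integrable_norm di.
suff : `|F n 0 - r| + int0 L (fun x => `|f n x - finf x|) @[n --> \oo] --> `|r - r| + 0.
  by rewrite subrr normr0 addr0.
by apply: cvgD => //; apply: cvg_norm; apply: cvgB => //; exact: cvg_cst.
Qed.

Lemma int0_dominated L f finf : 0 <= L -> (forall n, integrable0L L (f n)) ->
  cvg_dominated L f finf -> int0 L (f n) @[n --> \oo] --> int0 L finf.
Proof.
move=> L_ge0 fi ff; have pF n := primitive_on_int0 0 (fi n).
have F0 : 0 + int0 0 (f n) @[n --> \oo] --> (0 : R).
  by under eq_cvg do rewrite int0_0 addr0; exact: cvg_cst.
have [_ /unif_cvg_pointwise/(_ (mem_itv0_bound L_ge0))] :=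
  primitive_on_dominated L_ge0 pF ff F0.
by under eq_cvg do rewrite add0r; rewrite add0r.
Qed.

Lemma dirichlet_slope_cvg L (W Y z : nat -> R -> R) zinf : 0 < L ->
  (forall n, dirichlet L (W n) (Y n) (z n)) -> cvg_dominated L z zinf ->
  Y n 0 @[n --> \oo] --> L^-1 * - int0 L (fun s => (L - s) * zinf s).
Proof.
move=> L_gt0 dW [zz [g gi zg]]; have L_ge0 := ltW L_gt0.
have reflect_cont : {within `[0, L], continuous (fun s => L - s)}.
  by apply: continuous_subspaceT => s; apply: cvgB; [exact: cvg_cst|exact: cvg_id].
have moment_cvg : int0 L (fun s => (L - s) * z n s) @[n --> \oo]
    --> int0 L (fun s => (L - s) * zinf s).
  apply: (int0_dominated L_ge0).
    by move=> n; apply: integrable0LMr reflect_cont _; case: (dW n) => _ [].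
  split=> [s sL|]; first by apply: cvgM; [exact: cvg_cst|exact: zz].
  exists (fun s => L * g s) => [|n s sL]; first exact: integrable0LZ.
  rewrite normrM ler_pM ?zg// ger0_norm ?subr_ge0 ?(itvP sL)//.
  by rewrite gerBl (itvP sL).
under eq_cvg do
  rewrite -[Y _ 0](mulKf (lt0r_neq0 L_gt0)) (dirichlet_slope L_ge0 (dW _)).
by apply: cvgM; [exact: cvg_cst|exact: cvgN].
Qed.

Lemma dirichlet_dominated L (W Y z : nat -> R -> R) zinf : 0 < L ->
  (forall n, dirichlet L (W n) (Y n) (z n)) -> cvg_dominated L z zinf ->
  exists Winf Yinf, dirichlet L Winf Yinf zinf /\ unif_cvg L W Winf.
Proof.
move=> L_gt0 dW zz; have L_ge0 := ltW L_gt0; have memL := mem_itv0_bound L_ge0.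
have pW n : primitive_on L (W n) (Y n) by case: (dW n).
have pY n : primitive_on L (Y n) (z n) by case: (dW n).
have [slope slope_cvg] : exists slope : R, Y n 0 @[n --> \oo] --> slope.
  by eexists; exact: dirichlet_slope_cvg dW zz.
have [pYinf Ycvg] := primitive_on_dominated L_ge0 pY zz slope_cvg.
have [B YB] : exists B, forall n, {in `[0, L], forall x, `|Y n x| <= B}.
  have [B Y0B] := cvgn_normr_bounded slope_cvg; have [_ [g gi zg]] := zz.
  exists (B + int0 L g) => n x xL; rewrite (pY n).2//.
  apply: (le_trans (ler_normD _ _)); rewrite lerD//.
  exact: normr_int0_le (pY n).1 gi (zg n) xL.
have W0 : W n 0 @[n --> \oo] --> (0 : R).
  by apply: cvg_near_cst; apply: nearW => n; case: (dW n).
have YY : cvg_dominated L Y (fun x => slope + int0 x zinf).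
  split=> [x|]; first exact: (unif_cvg_pointwise Ycvg).
  by exists (fun=> B) => [|n]; [exact: integrable0L_cst|exact: YB].
have [pWinf Wcvg] := primitive_on_dominated L_ge0 pW YY W0.
eexists _, _; split; last exact: Wcvg.
split; [exact: pWinf|exact: pYinf|by rewrite int0_0 addr0|].
apply: (cvg_unique _ (unif_cvg_pointwise Wcvg memL)) => //.
by apply: cvg_near_cst; apply: nearW => n; case: (dW n).
Qed.

End dominated_limits.

Section hinged_order.
Context {R : realType} (L : R).
Implicit Types u w y z : hinged L.

Definition hinged_le u w :=
  forall x, x \in `[0, L] -> u x <= w x /\ d2 w x <= d2 u x.

Definition hinged_between lo hi u := hinged_le lo u /\ hinged_le u hi.

Definition hinged_cvg (u : nat -> hinged L) y :=
  unif_cvg L (fun n => u n : R -> R) y /\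
  {in `[0, L], forall x, d2 (u n) x @[n --> \oo] --> d2 y x}.

Lemma hinged_cvg_cst u : hinged_cvg (fun=> u) u.
Proof.
split=> [e e0|x _]; last exact: cvg_cst.
by exists 0 => n _ x _; rewrite subrr normr0.
Qed.

Lemma hinged_le_lim (u w : nat -> hinged L) y z : (forall n, hinged_le (u n) (w n)) ->
  hinged_cvg u y -> hinged_cvg w z -> hinged_le y z.
Proof.
move=> uw [uy uy2] [wz wz2] x xL; split.
  apply: (ler_cvg_to (unif_cvg_pointwise uy xL) (unif_cvg_pointwise wz xL)).
  by apply: nearW => n; have [] := uw n x xL.
apply: (ler_cvg_to (wz2 x xL) (uy2 x xL)).
by apply: nearW => n; have [] := uw n x xL.
Qed.

Lemma hinged_between_lim (u : nat -> hinged L) lo hi y :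
  (forall n, hinged_between lo hi (u n)) -> hinged_cvg u y -> hinged_between lo hi y.
Proof.
move=> u_lohi uy; split.
  by apply: hinged_le_lim (hinged_cvg_cst lo) uy => n; case: (u_lohi n).
by apply: hinged_le_lim uy (hinged_cvg_cst hi) => n; case: (u_lohi n).
Qed.

Lemma hinged_between_bounded lo hi : 0 <= L ->
  exists B, forall u, hinged_between lo hi u -> {in `[0, L], forall x, `|d2 u x| <= B}.
Proof.
move=> L_ge0.
have bounded w : exists B, {in `[0, L], forall x, `|d2 w x| <= B}.
  by have [_ [pd2 _ _ _]] := hinged_dirichlet w L_ge0; exact: primitive_on_bounded pd2.
have [[B1 loB] [B2 hiB]] := (bounded lo, bounded hi).
exists (B1 + B2) => u [lou uhi] x xL.
have [_ ulo] := lou x xL; have [_ hiu] := uhi x xL.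
move: (loB _ xL) (hiB _ xL); rewrite !ler_norml; lra.
Qed.

Lemma hinged_monotone_cvg (u : nat -> hinged L) lo hi :
  (forall n, hinged_between lo hi (u n)) ->
  (forall n, hinged_le (u n) (u n.+1)) \/ (forall n, hinged_le (u n.+1) (u n)) ->
  {in `[0, L], forall x, cvgn (fun n => d2 (u n) x)}.
Proof.
move=> u_lohi [mono|mono] x xL.
  apply: nonincreasing_is_cvgn.
    by apply/nonincreasing_seqP => n; have [] := mono n x xL.
  by exists (d2 hi x) => _ [n _ <-]; have [_ /(_ x xL)[]] := u_lohi n.
apply: nondecreasing_is_cvgn.
  by apply/nondecreasing_seqP => n; have [] := mono n x xL.
by exists (d2 lo x) => _ [n _ <-]; have [/(_ x xL)[]] := u_lohi n.
Qed.

End hinged_order.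

Section monotone_iteration.
Context {R : realType} (L a b c M N : R) (p : R -> R).
Hypotheses (L_gt0 : 0 < L) (b_gt0 : 0 < b) (M_gt0 : 0 < M) (N_gt0 : 0 < N).
Hypothesis N_le : N <= 4 * M / L ^+ 3 * sigma (Num.sqrt M * L).
Hypothesis p_integrable : integrable0L L p.
Implicit Types u w y z : hinged L.

Let L_ge0 : 0 <= L. Proof. exact: ltW. Qed.

Definition iteration_lhs y x := d4 y x - M * d2 y x + N * int0 L y.

Definition iteration_rhs z x :=
  p x + (a + b * int0 L z) * d2 z x - c * int0 L z - M * d2 z x + N * int0 L z.

Definition iterate z y := ae0L L (fun x => iteration_lhs y x = iteration_rhs z x).
Definition subiterate z y := ae0L L (fun x => iteration_lhs y x <= iteration_rhs z x).
Definition superiterate z y := ae0L L (fun x => iteration_rhs z x <= iteration_lhs y x).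

Definition solution y := is_solP L a b c p y (d1 y) (d2 y) (d3 y) (d4 y).

Definition lower_solution y := is_lowerP L a b c p y (d1 y) (d2 y) (d3 y) (d4 y).
Definition upper_solution y := is_upperP L a b c p y (d1 y) (d2 y) (d3 y) (d4 y).

Lemma iterate_sub z y : iterate z y -> subiterate z y.
Proof. by apply: ae0LS => x _ ->. Qed.

Lemma iterate_super z y : iterate z y -> superiterate z y.
Proof. by apply: ae0LS => x _ ->. Qed.

Lemma lower_subiterate y : lower_solution y -> subiterate y y.
Proof.
by case=> _ + _; apply: ae0LS => x _; rewrite /iteration_lhs /iteration_rhs /Pop; lra.
Qed.

Lemma upper_superiterate y : upper_solution y -> superiterate y y.
Proof.
by case=> _ + _; apply: ae0LS => x _; rewrite /iteration_lhs /iteration_rhs /Pop; lra.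
Qed.

Lemma solution_iterate y : solution y -> iterate y y.
Proof.
by case=> _ + _; apply: ae0LS => x _; rewrite /iteration_lhs /iteration_rhs /Pop; lra.
Qed.

Section comparison.
Variable be : hinged L.
Hypothesis be_M : a + b * int0 L be <= M.
Hypothesis be_N : {in `[0, L], forall x, c - b * d2 be x <= N}.

Lemma iteration_rhs_le z w x : hinged_le z w -> hinged_le w be -> x \in `[0, L] ->
  iteration_rhs z x <= iteration_rhs w x.
Proof.
move=> zw wbe xL; have [_ wz] := zw x xL; have [_ bw] := wbe x xL.
have zwI : int0 L z <= int0 L w.
  by apply: le_int0 => [||s /zw[]//]; exact: hinged_integrable.
have wbI : b * int0 L w <= b * int0 L be.
  by rewrite ler_pM2l//; apply: le_int0 => [||s /wbe[]//]; exact: hinged_integrable.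
have bz : b * d2 be x <= b * d2 z x by rewrite ler_pM2l// (le_trans bw).
rewrite -subr_ge0 (_ : _ - _ = (M - (a + b * int0 L w)) * (d2 z x - d2 w x)
  + (int0 L w - int0 L z) * (b * d2 z x + N - c)); last first.
  by rewrite /iteration_rhs; ring.
by have := be_N xL; have := be_M => aM cN; apply: addr_ge0; apply: mulr_ge0; lra.
Qed.

Lemma iteration_homo z w y u : hinged_le z w -> hinged_le w be ->
  subiterate z y -> superiterate w u -> hinged_le y u.
Proof.
move=> zw wbe zy wu x xL.
have := hinged_maximum_principle (u := hinged_sub L_ge0 u y)
  L_gt0 M_gt0 N_gt0 N_le _ xL.
rewrite /= !subr_ge0 subr_le0; apply.
rewrite int0B; [|exact: hinged_integrable..].
apply: ae0LS (ae0L_and zy wu) => s sL [zys wus].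
have := le_trans zys (le_trans (iteration_rhs_le zw wbe sL) wus).
rewrite /iteration_lhs; lra.
Qed.

Lemma iterates_homo (z w : nat -> hinged L) :
  (forall n, subiterate (z n) (z n.+1)) -> (forall n, superiterate (w n) (w n.+1)) ->
  (forall n, hinged_le (w n) be) -> hinged_le (z 0) (w 0) ->
  forall n, hinged_le (z n) (w n).
Proof.
move=> zS wS wbe zw0; elim=> // n zwn.
exact: iteration_homo zwn (wbe n) (zS n) (wS n).
Qed.

End comparison.

(* Only almost everywhere equal to [d4 y], but converges along with the iterates. *)
Definition iterate_d4 z y x :=
  p x + (a + b * int0 L z - M) * d2 z x + M * d2 y x
  + ((N - c) * int0 L z - N * int0 L y).

Lemma iterate_dirichlet z y : iterate z y ->
  dirichlet L (d2 y) (d3 y) (iterate_d4 z y).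
Proof.
move=> zy; have [_ [py py3 y0 yL]] := hinged_dirichlet y L_ge0; split=> //.
have [_ [pz _ _ _]] := hinged_dirichlet z L_ge0.
apply: ae_eq_primitive_on py3 _ _; last first.
  apply: ae0LS zy => x _; rewrite /iteration_lhs /iteration_rhs /iterate_d4; lra.
apply: integrable0LD; last exact: integrable0L_cst.
apply: integrable0LD; last exact/integrable0LZ/(primitive_on_integrable L_ge0 py).
apply: integrable0LD => //.
exact/integrable0LZ/(primitive_on_integrable L_ge0 pz).
Qed.

Lemma iterate_d4_dominated (u : nat -> hinged L) l I :
  cvg_dominated L (fun n => d2 (u n)) l -> int0 L (u n) @[n --> \oo] --> I ->
  cvg_dominated L (fun n => iterate_d4 (u n) (u n.+1))
    (fun x => p x + (a + b * I - M) * l x + M * l x + ((N - c) * I - N * I)).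
Proof.
move=> d2l int_cvg.
have int_cvgS : int0 L (u n.+1) @[n --> \oo] --> I.
  by rewrite (cvg_shiftS (fun n => int0 L (u n))).
apply: cvg_dominatedD; last first.
  by apply: cvg_dominated_cst; apply: cvgB; apply: cvgM => //; exact: cvg_cst.
apply: cvg_dominatedD.
  apply: cvg_dominatedD; first exact: cvg_dominated_const.
  apply: cvg_dominatedZ d2l; apply: cvgB; last exact: cvg_cst.
  by apply: cvgD; [exact: cvg_cst|apply: cvgM => //; exact: cvg_cst].
by apply: cvg_dominatedZ (cvg_dominatedS d2l); exact: cvg_cst.
Qed.

Lemma iterates_cvg (u : nat -> hinged L) (l : R -> R) :
  (forall n, iterate (u n) (u n.+1)) -> cvg_dominated L (fun n => d2 (u n)) l ->
  exists2 y, solution y & hinged_cvg u y.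
Proof.
move=> uS d2l; have [d2_l _] := d2l.
have [y [y1 [dy uy]]] :=
  dirichlet_dominated L_gt0 (fun n => (hinged_dirichlet (u n) L_ge0).1) d2l.
have intu n : integrable0L L (u n) by exact: hinged_integrable.
have int_cvg := unif_cvg_int0 L_gt0 intu (dirichlet_integrable L_ge0 dy) uy.
have [y2 [y3 [dy2 d2_y2]]] := dirichlet_dominated L_gt0
  (fun n => iterate_dirichlet (uS n)) (iterate_d4_dominated d2l int_cvg).
have l_y2 : {in `[0, L], l =1 y2}.
  move=> x xL; have := unif_cvg_pointwise d2_y2 xL.
  rewrite (cvg_shiftS (fun n => d2 (u n) x)) => d2_y2x.
  exact: cvg_unique (d2_l x xL) d2_y2x.
have {}dy : dirichlet L y y1 y2.
  by case: dy => py py1 y0 yL; split=> //; exact: eq_primitive_on py1.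
exists (hinged_of_dirichlet dy dy2); last first.
  by split=> // x xL; rewrite /= -l_y2//; exact: d2_l.
split; [exact: hinged_W41|apply: ae0LT => x xL|exact: hinged_BC].
by rewrite /Pop /= l_y2//; ring.
Qed.

Lemma monotone_iterates_cvg (u : nat -> hinged L) lo hi :
  (forall n, iterate (u n) (u n.+1)) ->
  (forall n, hinged_between lo hi (u n)) ->
  (forall n, hinged_le (u n) (u n.+1)) \/ (forall n, hinged_le (u n.+1) (u n)) ->
  exists2 y, solution y & hinged_cvg u y.
Proof.
move=> uS u_lohi mono; have [B uB] := hinged_between_bounded lo hi L_ge0.
apply: (iterates_cvg (l := fun x => limn (fun n => d2 (u n) x)) uS); split.
  exact: hinged_monotone_cvg u_lohi mono.
by exists (fun=> B) => [|n]; [exact: integrable0L_cst|exact: uB].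
Qed.

Section extremal_solutions.
Variables alpha beta : nat -> hinged L.
Hypothesis alpha_lower : lower_solution (alpha 0).
Hypothesis beta_upper : upper_solution (beta 0).
Hypothesis alpha_beta : hinged_le (alpha 0) (beta 0).
Hypothesis beta_M : a + b * int0 L (beta 0) <= M.
Hypothesis beta_N : {in `[0, L], forall x, c - b * d2 (beta 0) x <= N}.
Hypothesis alphaS : forall n, iterate (alpha n) (alpha n.+1).
Hypothesis betaS : forall n, iterate (beta n) (beta n.+1).

Let homo := iterates_homo beta_M beta_N.
Let alpha_sub n : subiterate (alpha n) (alpha n.+1) := iterate_sub (alphaS n).
Let alpha_super n : superiterate (alpha n) (alpha n.+1) := iterate_super (alphaS n).
Let beta_sub n : subiterate (beta n) (beta n.+1) := iterate_sub (betaS n).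
Let beta_super n : superiterate (beta n) (beta n.+1) := iterate_super (betaS n).

Lemma alpha_le_beta0 n : hinged_le (alpha n) (beta 0).
Proof.
apply: (homo (w := fun=> beta 0) alpha_sub) => // _.
exact: upper_superiterate.
Qed.

Lemma beta_le_beta0 n : hinged_le (beta n) (beta 0).
Proof.
apply: (homo (w := fun=> beta 0) beta_sub) => // _.
exact: upper_superiterate.
Qed.

Lemma alpha_between n : hinged_between (alpha 0) (beta 0) (alpha n).
Proof.
split; last exact: alpha_le_beta0.
apply: (homo (z := fun=> alpha 0) _ alpha_super alpha_le_beta0) => // _.
exact: lower_subiterate.
Qed.

Lemma beta_between n : hinged_between (alpha 0) (beta 0) (beta n).
Proof.
split; last exact: beta_le_beta0.
apply: (homo (z := fun=> alpha 0) _ beta_super beta_le_beta0) => // _.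
exact: lower_subiterate.
Qed.

Lemma alpha_nondecreasing n : hinged_le (alpha n) (alpha n.+1).
Proof.
exact: (homo (w := alpha \o succn) alpha_sub (fun n => alpha_super n.+1)
  (fun n => alpha_le_beta0 n.+1) (alpha_between 1).1).
Qed.

Lemma beta_nonincreasing n : hinged_le (beta n.+1) (beta n).
Proof.
exact: (homo (z := beta \o succn) (fun n => beta_sub n.+1) beta_super
  beta_le_beta0 (beta_le_beta0 1)).
Qed.

Lemma alpha_le_beta n : hinged_le (alpha n) (beta n).
Proof. exact: homo alpha_sub beta_super beta_le_beta0 alpha_beta n. Qed.

Lemma solution_between_iterates y n : solution y ->
  hinged_between (alpha 0) (beta 0) y -> hinged_between (alpha n) (beta n) y.
Proof.
move=> /solution_iterate yy [al_y y_be]; split.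
  by apply: (homo (w := fun=> y) alpha_sub) => // _; exact: iterate_super.
by apply: (homo (z := fun=> y) _ beta_super beta_le_beta0) => // _; exact: iterate_sub.
Qed.

Theorem monotone_iteration :
  (forall n, [/\ hinged_le (alpha n) (alpha n.+1), hinged_le (alpha n) (beta n)
              & hinged_le (beta n.+1) (beta n)]) /\
  exists lo hi,
    [/\ solution lo /\ hinged_between (alpha 0) (beta 0) lo,
        solution hi /\ hinged_between (alpha 0) (beta 0) hi,
        hinged_cvg alpha lo /\ hinged_cvg beta hi
      & forall y, solution y -> hinged_between (alpha 0) (beta 0) y ->
          hinged_between lo hi y].
Proof.
split=> [n|]; first by split;
  [exact: alpha_nondecreasing|exact: alpha_le_beta|exact: beta_nonincreasing].
have [lo lo_sol lo_cvg] := monotone_iterates_cvg alphaS alpha_between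
  (or_introl alpha_nondecreasing).
have [hi hi_sol hi_cvg] := monotone_iterates_cvg betaS beta_between
  (or_intror beta_nonincreasing).
exists lo, hi; split=> //.
- by split=> //; exact: hinged_between_lim alpha_between lo_cvg.
- by split=> //; exact: hinged_between_lim beta_between hi_cvg.
move=> y y_sol y_be; split.
  apply: hinged_le_lim lo_cvg (hinged_cvg_cst y) => n.
  by case: (solution_between_iterates n y_sol y_be).
apply: hinged_le_lim (hinged_cvg_cst y) hi_cvg => n.
by case: (solution_between_iterates n y_sol y_be).
Qed.

End extremal_solutions.
End monotone_iteration.

Lemma in_ab_between {R : realType} (L : R) (al be u : hinged L) :
  in_ab L al (d2 al) be (d2 be) u (d2 u) <-> hinged_between al be u.
Proof.
split=> [abu|[alu ube] x xL]; first by split=> x /abu[].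
by have [? ?] := alu x xL; have [? ?] := ube x xL.
Qed.

Lemma is_iterP_hinged {R : realType} (L a b c M N : R) (p : R -> R)
    (u u1 u2 u3 u4 : nat -> R -> R) :
  W41 L (u 0%N) (u1 0%N) (u2 0%N) (u3 0%N) (u4 0%N) /\ BC L (u 0%N) (u2 0%N) ->
  (forall n, is_iterP L a b c M N p (u n) (u2 n)
    (u n.+1) (u1 n.+1) (u2 n.+1) (u3 n.+1) (u4 n.+1)) ->
  forall n, W41 L (u n) (u1 n) (u2 n) (u3 n) (u4 n) /\ BC L (u n) (u2 n).
Proof. by move=> u0 uS [//|n]; case: (uS n). Qed.

Theorem theorem4p1 (R : realType) (L a b c M N : R) (p : R -> R)
  (al al1 al2 al3 al4 be be1 be2 be3 be4 : R -> R)
  (als als1 als2 als3 als4 bes bes1 bes2 bes3 bes4 : nat -> R -> R) :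
  0 < L -> 0 < a -> 0 < b -> 0 < c -> 0 < M -> 0 < N ->
  (@lebesgue_measure R).-integrable `[0, L] (EFin \o p) ->
  N <= 4 * M / L ^+ 3 * sigma (Num.sqrt M * L) ->
  is_lowerP L a b c p al al1 al2 al3 al4 ->
  is_upperP L a b c p be be1 be2 be3 be4 ->
  (forall x, x \in `[0, L] ->
     [/\ 0 <= al x, al x <= be x, al2 x <= 0 & be2 x <= al2 x]) ->
  a + b * int0 L be <= M ->
  (exists2 x0, x0 \in `[0, L] &
     (forall x, x \in `[0, L] -> be2 x0 <= be2 x) /\ c - b * be2 x0 <= N) ->
  (* the iteration sequences starting at alpha and at beta *)
  [/\ als 0%N = al, als1 0%N = al1, als2 0%N = al2, als3 0%N = al3
    & als4 0%N = al4] ->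
  [/\ bes 0%N = be, bes1 0%N = be1, bes2 0%N = be2, bes3 0%N = be3
    & bes4 0%N = be4] ->
  (forall n : nat, is_iterP L a b c M N p (als n) (als2 n)
     (als n.+1) (als1 n.+1) (als2 n.+1) (als3 n.+1) (als4 n.+1)) ->
  (forall n : nat, is_iterP L a b c M N p (bes n) (bes2 n)
     (bes n.+1) (bes1 n.+1) (bes2 n.+1) (bes3 n.+1) (bes4 n.+1)) ->
  (* conclusions *)
  (exists y y1 y2 y3 y4,
     is_solP L a b c p y y1 y2 y3 y4 /\ in_ab L al al2 be be2 y y2) /\
  (forall (n : nat) x, x \in `[0, L] ->
     [/\ als n x <= als n.+1 x, als n x <= bes n x & bes n.+1 x <= bes n x] /\
     [/\ als2 n.+1 x <= als2 n x, bes2 n x <= als2 n x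
       & bes2 n x <= bes2 n.+1 x]) /\
  (exists (ylo ylo1 ylo2 ylo3 ylo4 yhi yhi1 yhi2 yhi3 yhi4 : R -> R),
     [/\ is_solP L a b c p ylo ylo1 ylo2 ylo3 ylo4 /\
           in_ab L al al2 be be2 ylo ylo2,
         is_solP L a b c p yhi yhi1 yhi2 yhi3 yhi4 /\
           in_ab L al al2 be be2 yhi yhi2,
         unif_cvg L als ylo /\ unif_cvg L bes yhi &
         forall y y1 y2 y3 y4, is_solP L a b c p y y1 y2 y3 y4 ->
           in_ab L al al2 be be2 y y2 ->
           forall x, x \in `[0, L] ->
             [/\ ylo x <= y x, y x <= yhi x, y2 x <= ylo2 x & yhi2 x <= y2 x]]).
Proof.
move=> L_gt0 _ b_gt0 _ M_gt0 N_gt0 p_integrable N_le al_lower be_upper al_be be_M.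
move=> [x0 _ [be2_min be_N]] [? ? ? ? ?] [? ? ? ? ?] alsS besS.
subst al al1 al2 al3 al4 be be1 be2 be3 be4.
have alsP := is_iterP_hinged (let: And3 W _ bc := al_lower in conj W bc) alsS.
have besP := is_iterP_hinged (let: And3 W _ bc := be_upper in conj W bc) besS.
pose alpha n := Hinged (alsP n).1 (alsP n).2.
pose beta n := Hinged (besP n).1 (besP n).2.
have alpha_beta : hinged_le (alpha 0) (beta 0) by move=> x /al_be[].
have beta_N : {in `[0, L], forall x, c - b * d2 (beta 0) x <= N}.
  by move=> x /be2_min be2_x0; apply: le_trans be_N; rewrite lerD2l lerN2 ler_pM2l.
have [mono [lo [hi [[lo_sol lo_ab] [hi_sol hi_ab] [[lo_cvg _] [hi_cvg _]] ext]]]] :=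
  monotone_iteration (alpha := alpha) (beta := beta) L_gt0 b_gt0 M_gt0 N_gt0 N_le
  p_integrable al_lower be_upper alpha_beta be_M beta_N
  (fun n => let: And3 _ e _ := alsS n in e) (fun n => let: And3 _ e _ := besS n in e).
have in_abP := in_ab_between (alpha 0) (beta 0).
move: lo_ab hi_ab => /in_abP lo_ab /in_abP hi_ab.
split; first by exists lo, (d1 lo), (d2 lo), (d3 lo), (d4 lo).
split=> [n x xL|].
  by have [/(_ x xL)[? ?] /(_ x xL)[? ?] /(_ x xL)[? ?]] := mono n.
exists lo, (d1 lo), (d2 lo), (d3 lo), (d4 lo), hi, (d1 hi), (d2 hi), (d3 hi), (d4 hi).
split=> // y y1 y2 y3 y4 y_sol y_ab x xL; have [yW _ yBC] := y_sol.
have [] := ext (Hinged yW yBC) y_sol ((in_abP (Hinged yW yBC)).1 y_ab).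
by move=> /(_ x xL)[? ?] /(_ x xL)[? ?].
Qed.
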